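(* Let $X$ be a topological space. Then $X$ is homeomorphic to the edge-end space $\Omega_E(G)$ of some graph $G$ if, and only if, $X$ admits a clopen subbase $\mathcal{C}$ which is nested, noetherian, hereditarily complete and verifies the following singleton intersection property: for every strictly $\subseteq$-decreasing chain $C_0\supsetneq C_1\supsetneq C_2\supsetneq C_3\supsetneq\dots$ in $\mathcal{C}$, the intersection $\bigcap_{n\in\mathbb{N}}C_n$ contains a unique element (i.e. exactly one element).
   Context: Edge-end spaces. A ray of a graph $G$ is a subgraph whose vertex set is a sequence $\{v_n\}_{n\in\mathbb{N}}$ of pairwise distinct vertices and whose edge set is $\{v_nv_{n+1}:n\in\mathbb{N}\}$ (a one-way infinite path). The tails of a ray are the rays contained in it (its infinite connected subgraphs). Two rays $r,s$ of $G$ are edge-equivalent if for every finite set of edges $F\subseteq E(G)$ the rays $r$ and $s$ have tails in the same connected component of $G\setminus F$. The edge-equivalence class of $r$ is denoted $[r]_E$ and called its edge-end; $\Omega_E(G):=\{[r]_E: r\text{ is a ray of }G\}$. For a finite $F\subseteq E(G)$, let $C_E(F,[r]_E)$ be the connected component of $G\setminus F$ containing a tail of $r$ (well defined). The sets $\Omega_E(F,[r]_E):=\{[s]_E\in\Omega_E(G): C_E(F,[s]_E)=C_E(F,[r]_E)\}$, for $F\subseteq E(G)$ finite, are the basic open neighborhoods of $[r]_E$; with this topology $\Omega_E(G)$ is called the edge-end space of $G$. Subbase properties. Let $\mathcal{C}$ be a family of non-empty subsets of a topological space $X$. - $\mathcal{C}$ is a clopen subbase of $X$ if $\mathcal{C}\cup\{X\setminus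 C: C\in\mathcal{C}\}$ is a subbase for the topology of $X$. - $\mathcal{C}$ is nested if $C\subseteq D$ or $D\subseteq C$ whenever $C,D\in\mathcal{C}$ intersect. - $\mathcal{C}$ is noetherian if there is no infinite strictly $\subseteq$-ascending chain in $\mathcal{C}$, i.e. for every sequence $C_0\subseteq C_1\subseteq C_2\subseteq\dots$ in $\mathcal{C}$ there is $n\in\mathbb{N}$ with $C_n=C_m$ for every $m\geq n$. - A family of sets is centered if $\bigcap\mathcal{F}\neq\emptyset$ for every non-empty finite subfamily $\mathcal{F}$. A family of subsets of a space is complete if each of its non-empty centered subfamilies has non-empty intersection. - $\mathcal{C}$ is hereditarily complete if $\{C\cap Y: C\in\mathcal{C}\}$ is complete in $Y$ for each closed subspace $Y\subseteq X$.
   Formalization: The space X is additionally assumed to be T0 (Kolmogorov): every edge-end space is T0, whereas the two-point indiscrete space admits the clopen subbase {X} with all the listed properties, so the equivalence fails without a separation axiom. *)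

(* Defs.v *)
From HB Require Import structures.
From mathcomp Require Import all_boot all_order.
From mathcomp Require Import all_classical.
From mathcomp Require Import topology.
From Stdlib Require Import Relation_Operators.

Set Implicit Arguments.
Unset Strict Implicit.
Unset Printing Implicit Defensive.

Local Open Scope classical_set_scope.

(* Simple undirected graphs of arbitrary cardinality; an edge is a two-element
   set of vertices. *)
Record graph : Type := Graph {
  vertex :> Type;
  edges : set (set vertex);
  edgesP : forall a, edges a -> exists u v, u <> v /\ a = [set u; v]
}.

Arguments edges : clear implicits.

Definition adj (G : graph) (u v : G) : Prop := edges G [set u; v].

Lemma del_edges_subproof (G : graph) (F : set (set G)) (a : set G) :
  (edges G `\` F) a -> exists u v, u <> v /\ a = [set u; v].
Proof. by move=> [/edgesP]. Qed.

Definition del_edges (G : graph) (F : set (set G)) : graph :=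
  Graph (@del_edges_subproof G F).

Definition linked (G : graph) : G -> G -> Prop := clos_refl_trans G (@adj G).

Definition is_component (G : graph) (C : set G) : Prop :=
  exists v, C = [set w | linked v w].

(* The ray with vertices r 0, r 1, ...; the subgraph determines this sequence,
   since r 0 is its only vertex of degree one. *)
Record ray (G : graph) : Type := Ray {
  ray_seq :> nat -> G;
  ray_inj : injective ray_seq;
  ray_adj : forall n, adj (ray_seq n) (ray_seq n.+1)
}.

Definition ray_vertices (G : graph) (r : ray G) : set G := range r.

Definition ray_edges (G : graph) (r : ray G) : set (set G) :=
  range (fun n => [set r n; r n.+1]).

Definition tail (G : graph) (t r : ray G) : Prop :=
  ray_vertices t `<=` ray_vertices r /\ ray_edges t `<=` ray_edges r.

(* t is a subgraph of the component of G \ F with vertex set C. *)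
Definition ray_within (G : graph) (F : set (set G)) (C : set G) (t : ray G) :
    Prop :=
  ray_vertices t `<=` C /\ ray_edges t `<=` edges (del_edges F).

Definition finite_edge_set (G : graph) (F : set (set G)) : Prop :=
  finite_set F /\ F `<=` edges G.

Definition edge_equiv (G : graph) (r s : ray G) : Prop :=
  forall F : set (set G), finite_edge_set F ->
    exists C : set G, [/\ @is_component (del_edges F) C,
      exists2 t, tail t r & ray_within F C t &
      exists2 t, tail t s & ray_within F C t].

Definition edge_class (G : graph) (r : ray G) : set (ray G) :=
  [set s | edge_equiv r s].

Record edge_end (G : graph) : Type := EdgeEnd {
  end_class : set (ray G);
  end_classP : exists r, end_class = edge_class r
}.

HB.instance Definition _ (G : graph) := gen_eqMixin (edge_end G).
HB.instance Definition _ (G : graph) := gen_choiceMixin (edge_end G).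

Definition has_tail_of_end (G : graph) (F : set (set G)) (e : edge_end G)
    (C : set G) : Prop :=
  @is_component (del_edges F) C /\
  exists r t : ray G, [/\ end_class e r, tail t r & ray_within F C t].

(* C_E(F, e). For finite F the component exists and is unique: see
   end_componentP and end_component_eq below. *)
Definition end_component (G : graph) (F : set (set G)) (e : edge_end G) :
    set G :=
  get [set C | has_tail_of_end F e C].

(* Omega_E(F, e) *)
Definition end_nbhd (G : graph) (F : set (set G)) (e : edge_end G) :
    set (edge_end G) :=
  [set e' | end_component F e' = end_component F e].

Definition end_open (G : graph) (U : set (edge_end G)) : Prop :=
  forall e, U e -> exists2 F, finite_edge_set F & end_nbhd F e `<=` U.

Section Components.
Variable G : graph.
Implicit Types (F : set (set G)) (C D : set G) (r s t : ray G).

Lemma linked_sym (H : graph) (u v : H) : linked u v -> linked v u.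
Proof.
elim=> [x y xy|x|x y z _ yx _ zy].
- by apply: rt_step; rewrite /adj setUC.
- exact: rt_refl.
- exact: rt_trans zy yx.
Qed.

Lemma is_component_eq (H : graph) (C D : set H) x :
  is_component C -> is_component D -> C x -> D x -> C = D.
Proof.
move=> [u ->] [v ->] /= ux vx; apply/seteqP; split => w /= h.
- by apply: rt_trans vx _; apply: rt_trans (linked_sym ux) h.
- by apply: rt_trans ux _; apply: rt_trans (linked_sym vx) h.
Qed.

Lemma pair_eqE (T : Type) (a b c d : T) :
  [set a; b] = [set c; d] -> a = c /\ b = d \/ a = d /\ b = c.
Proof.
move=> E.
have Ea : [set c; d] a by rewrite -E; left.
have Eb : [set c; d] b by rewrite -E; right.
have Ec : [set a; b] c by rewrite E; left.
have Ed : [set a; b] d by rewrite E; right.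
by case: Ea; case: Eb; case: Ec; case: Ed => /= *; subst; tauto.
Qed.

Lemma ray_edge_inj r : injective (fun n => [set r n; r n.+1]).
Proof.
move=> m n /= E0; case: (pair_eqE E0) => -[E E']; first exact: (ray_inj E).
have := ray_inj E'; rewrite (ray_inj E) => /eqP.
by rewrite -[X in _ == X]addn0 -addn2 eqn_add2l.
Qed.

Lemma tailP t r : tail t r <-> exists k, forall n, t n = r (k + n).
Proof.
split=> [[tv te]|[k tk]]; last first.
  split=> [_ [n _ <-]|_ [n _ <-]]; exists (k + n) => //.
  by rewrite !tk addnS.
have /choice[f fE] : forall n, exists m, t n = r m.
  by move=> n; have [|m _ <-] := tv (t n); [exists n | exists m].
have f_inj : injective f by move=> m n E; apply: (@ray_inj _ t); rewrite !fE E.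
have fS n : f n.+1 = (f n).+1 \/ f n = (f n.+1).+1.
  have [|m _] := te [set t n; t n.+1]; first by exists n.
  rewrite !fE => E0; case: (pair_eqE E0) => -[E E'].
    by left; rewrite -(ray_inj E) -(ray_inj E').
  by right; rewrite -(ray_inj E) -(ray_inj E').
have up n : f n.+1 = (f n).+1.
  have [//|fn] := fS n.
  have down k : f (n + k).+1 + k.+1 = f n /\ f (n + k) = (f (n + k).+1).+1.
    elim: k => [|k [IH1 IH2]]; first by rewrite addn0 addn1.
    rewrite addnS; have [E|E] := fS (n + k).+1.
      have /f_inj/eqP : f (n + k).+2 = f (n + k) by rewrite E IH2.
      by rewrite -[X in _ == X]addn0 -addn2 eqn_add2l.
    by rewrite !addnS; split=> //; rewrite -IH1 E !addnS addSn.
  have [E _] := down (f n); have : f n < f n by rewrite -[X in _ < X]E addnS ltnS leq_addl.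
  by rewrite ltnn.
exists (f 0) => n; rewrite fE; congr (r _).
by elim: n => [|n IH]; rewrite ?addn0 // up IH addnS.
Qed.

Lemma shift_adj r k n : adj (r (k + n)) (r (k + n.+1)).
Proof. by rewrite addnS; exact: ray_adj. Qed.

Lemma shift_inj r k : injective (fun n => r (k + n)).
Proof. by move=> m n E; apply: (@addnI k); exact: (ray_inj E). Qed.

Definition shift r k : ray G := Ray (@shift_inj r k) (@shift_adj r k).

Lemma shift_tail r k : tail (shift r k) r.
Proof. by apply/tailP; exists k. Qed.

(* Past some index the ray avoids the finite set F. *)
Lemma ray_avoids F r : finite_set F ->
  exists k, forall n, ~ F [set r (k + n); r (k + n).+1].
Proof.
move=> Ffin.
have : finite_set ((fun n => [set r n; r n.+1]) @^-1` F).
  by apply: finite_preimage => // m n _ _; exact: ray_edge_inj.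
move=> /finite_seqP[s sE].
exists (\max_(i <- s) i).+1 => n Fn.
have : ((fun n => [set r n; r n.+1]) @^-1` F) ((\max_(i <- s) i).+1 + n) by [].
rewrite sE /= => si.
have := @leq_bigmax_seq _ s predT id _ si isT.
by rewrite leqNgt addSn ltnS leq_addr.
Qed.

Lemma ray_within_component F t :
  ray_edges t `<=` edges (del_edges F) ->
  ray_within F [set w | @linked (del_edges F) (t 0) w] t.
Proof.
move=> te; split=> // _ [n _ <-] /=; elim: n => [|n IH]; first exact: rt_refl.
by apply: rt_trans IH _; apply: rt_step; apply: te; exists n.
Qed.

Lemma ray_has_component F r : finite_set F ->
  exists C, @is_component (del_edges F) C /\
    exists2 t, tail t r & ray_within F C t.
Proof.
move=> /(@ray_avoids _ r)[k kF].
exists [set w | @linked (del_edges F) (shift r k 0) w]; split; first by exists (r (k + 0)).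
exists (shift r k); first exact: shift_tail.
apply: ray_within_component => _ [n _ <-] /=; rewrite addnS; split => //.
exact: ray_adj.
Qed.

Lemma ray_component_unique F C D r t t' :
  @is_component (del_edges F) C -> @is_component (del_edges F) D ->
  tail t r -> tail t' r -> ray_within F C t -> ray_within F D t' -> C = D.
Proof.
move=> cC cD /tailP[k tk] /tailP[k' tk'] [tC _] [tD _].
apply: (@is_component_eq (del_edges F) _ _ (r (k + k')) cC cD).
- by apply: tC; exists k'; rewrite ?tk.
- by apply: tD; exists k; rewrite // tk' addnC.
Qed.

Lemma edge_equiv_refl r : edge_equiv r r.
Proof.
move=> F [Ffin _]; have [C [cC [t tr tC]]] := ray_has_component r Ffin.
by exists C; split=> //; exists t.
Qed.

Lemma end_componentP F (e : edge_end G) : finite_set F ->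
  has_tail_of_end F e (end_component F e).
Proof.
move=> Ffin; have [r er] := end_classP e.
have [C [cC [t tr tC]]] := ray_has_component r Ffin.
apply: (@getI _ [set D | has_tail_of_end F e D] C).
split=> //; exists r, t; split=> //; rewrite er; exact: edge_equiv_refl.
Qed.

Lemma has_tail_unique F (e : edge_end G) C D : finite_edge_set F ->
  has_tail_of_end F e C -> has_tail_of_end F e D -> C = D.
Proof.
move=> fF [cC [r [t [er tr tC]]]] [cD [s [u [es us uD]]]].
have [r0 e0] := end_classP e; rewrite e0 in er es.
have [A [cA [a0 a0r a0A] [a ar aA]]] := er F fF.
have [B [cB [b0 b0r b0B] [b bs bB]]] := es F fF.
rewrite (ray_component_unique cC cA tr ar tC aA).
rewrite (ray_component_unique cD cB us bs uD bB).
exact: (ray_component_unique cA cB a0r b0r a0A b0B).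
Qed.

Lemma end_component_eq F (e : edge_end G) C : finite_edge_set F ->
  has_tail_of_end F e C -> end_component F e = C.
Proof.
move=> fF; apply: has_tail_unique => //.
by apply: end_componentP; case: fF.
Qed.

Lemma linked_del F F' (u v : G) : F `<=` F' ->
  @linked (del_edges F') u v -> @linked (del_edges F) u v.
Proof.
move=> FF'; elim=> [x y [xy nF]|x|x y z _ IH1 _ IH2].
- by apply: rt_step; split=> // /FF'.
- exact: rt_refl.
- exact: rt_trans IH1 IH2.
Qed.

Lemma end_nbhd_anti F F' (e : edge_end G) :
  finite_edge_set F -> finite_edge_set F' -> F `<=` F' ->
  end_nbhd F' e `<=` end_nbhd F e.
Proof.
move=> fF fF' FF' e' /= E.
have widen (f : edge_end G) v : end_component F' f = [set w | @linked (del_edges F') v w] ->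
    end_component F f = [set w | @linked (del_edges F) v w].
  move=> Ev; apply: end_component_eq => //; split; first by exists v.
  have [_ [r [t [fr tr [tv te]]]]] := end_componentP f (proj1 fF').
  exists r, t; split=> //; rewrite Ev in tv; split=> [x /tv|a /te[ea nFa]].
    exact: linked_del.
  by split=> // /FF'.
have [[v Ev] _] := end_componentP e (proj1 fF').
by rewrite /end_nbhd /= (widen e v Ev) (widen e' v) // E.
Qed.

Lemma end_openT : end_open [set: edge_end G].
Proof. by move=> e _; exists set0 => //; split. Qed.

Lemma end_openI (U V : set (edge_end G)) :
  end_open U -> end_open V -> end_open (U `&` V).
Proof.
move=> oU oV e [/oU[F fF FU] /oV[F' fF' FV]].
have fFF' : finite_edge_set (F `|` F').
  split; first by rewrite finite_setU; split; [case: fF|case: fF'].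
  by move=> a [/(proj2 fF)|/(proj2 fF')].
exists (F `|` F') => // e' h; split.
- by apply: FU; apply: end_nbhd_anti h => //; exact: subsetUl.
- by apply: FV; apply: end_nbhd_anti h => //; exact: subsetUr.
Qed.

Lemma end_open_bigU (I : Type) (f : I -> set (edge_end G)) :
  (forall i, end_open (f i)) -> end_open (\bigcup_i f i).
Proof.
move=> fo e [i _ /fo[F fF Ff]]; exists F => //.
by apply: subset_trans Ff _ => x fx; exists i.
Qed.

End Components.

HB.instance Definition _ (G : graph) := isOpenTopological.Build (edge_end G)
  (@end_openT G) (@end_openI G) (@end_open_bigU G).

Lemma open_end_nbhd (G : graph) (F : set (set G)) (e : edge_end G) :
  finite_edge_set F -> open (end_nbhd F e).
Proof.
move=> fF; suff : end_open (end_nbhd F e) by [].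
by move=> e' E; exists F => // e'' /= E'; rewrite /end_nbhd /= E'.
Qed.

Definition homeomorphic (X Y : topologicalType) : Prop :=
  exists (f : X -> Y) (g : Y -> X),
    [/\ cancel f g, cancel g f, continuous f & continuous g].

(* The empty intersection, that is the whole space, belongs to finI_from S id. *)
Definition subbase (X : topologicalType) (S : set (set X)) : Prop :=
  basis (finI_from S id).

Definition clopen_subbase (X : topologicalType) (C : set (set X)) : Prop :=
  (forall A, C A -> A !=set0) /\ subbase (C `|` [set ~` A | A in C]).

Definition nested (T : Type) (C : set (set T)) : Prop :=
  forall A B, C A -> C B -> A `&` B !=set0 -> A `<=` B \/ B `<=` A.

Definition noetherian (T : Type) (C : set (set T)) : Prop :=
  forall c : nat -> set T, (forall n, C (c n)) ->
    (forall n, c n `<=` c n.+1) ->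
    exists n, forall m, n <= m -> c n = c m.

Definition centered (T : Type) (F : set (set T)) : Prop :=
  forall F', F' `<=` F -> finite_set F' -> F' !=set0 ->
    \bigcap_(A in F') A !=set0.

Definition complete_family (T : Type) (C : set (set T)) : Prop :=
  forall F, F `<=` C -> F !=set0 -> centered F -> \bigcap_(A in F) A !=set0.

(* The traces on Y are kept as subsets of X: an intersection of a non-empty
   family of them is the same in Y and in X. *)
Definition hereditarily_complete (X : topologicalType) (C : set (set X)) :
    Prop :=
  forall Y : set X, closed Y -> complete_family [set A `&` Y | A in C].

Definition singleton_intersection (T : Type) (C : set (set T)) : Prop :=
  forall c : nat -> set T, (forall n, C (c n)) ->
    (forall n, c n.+1 `<` c n) ->
    exists! x, (\bigcap_n c n) x.

(* Main.v *)
(** Two rays are edge-equivalent iff no vertex set with finite edge boundary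
    separates them, so the sets of edge-ends living in such vertex sets form a
    base of clopen sets.

    From a graph to a subbase, a tree of vertex sets with finite boundary is
    grown from the connected components.  A connected region D receives a root o,
    and its children are disjoint connected subsets of D with finite boundary,
    avoiding o, such that every finite-boundary subset of D avoiding o is covered
    by finitely many of them.  The ends of D living in no child are those that
    cannot be separated from o, so there is at most one of them.  Choosing the
    roots as close as possible to a fixed vertex of the component makes the
    intersection of every branch empty, and an infinite branch then contains
    exactly one end.

    From a subbase to a graph, hereditary completeness forces every member to lie
    at a finite level of the tree of members ordered by reverse inclusion.  The
    points of X are the infinite branches of this tree together with some of its
    nodes; attaching an infinite complete graph to each of these nodes turns
    exactly them into edge-ends. *)
Require Import Defs.
From mathcomp Require Import all_boot all_order.
From mathcomp Require Import all_classical.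
From mathcomp Require Import topology.
From Stdlib Require Import Relation_Operators Operators_Properties.

Set Implicit Arguments.
Unset Strict Implicit.
Unset Printing Implicit Defensive.

Local Open Scope classical_set_scope.

(** * Chains of sets and connectivity of relations *)

Lemma dep_choice (T : Type) (P : T -> Prop) (R : T -> T -> Prop) x0 :
  P x0 -> (forall x, P x -> exists y, P y /\ R x y) ->
  exists f : nat -> T, [/\ f 0 = x0, forall n, P (f n) &
    forall n, R (f n) (f n.+1)].
Proof.
move=> Px0 step.
have step' (x : {x | P x}) : {y : {x | P x} | R (sval x) (sval y)}.
  by apply: cid; case: x => x /= /step[y [Py Rxy]]; exists (exist _ y Py).
have [f [f0 fS]] := dependent_choice step' (exist _ x0 Px0).
exists (fun n => sval (f n)); split=> [|n|n]; first by rewrite f0.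
- exact: svalP (f n).
- exact: fS.
Qed.

Lemma descending_le (T : Type) (c : nat -> set T) :
  (forall n, c n.+1 `<=` c n) -> forall m n, m <= n -> c n `<=` c m.
Proof.
move=> cS m n /subnKC <-; elim: (n - m) => [|k IH]; first by rewrite addn0.
by rewrite addnS; apply: subset_trans (cS _) IH.
Qed.

(** Without a least set, comparability gives every member a strictly smaller one, and dependent
    choice strings these into a sequence. A typical use is the family of members containing a fixed
    point or hosting a fixed end. *)
Lemma least_or_descending (T : Type) (B : set (set T)) :
  B !=set0 -> (forall A A', B A -> B A' -> A `<=` A' \/ A' `<=` A) ->
  (exists2 A, B A & forall A', B A' -> A `<=` A') \/
  exists2 c : nat -> set T, forall n, B (c n) & forall n, c n.+1 `<` c n.
Proof.
move=> [A0 BA0] cmp; have [|nleast] := pselect (exists2 A, B A & forall A', B A' -> A `<=` A').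
  by left.
right; have [|c [_ Bc cS]] := @dep_choice _ B (fun A A' => A' `<` A) _ BA0.
  move=> A BA; apply: contrapT => H; apply: nleast; exists A => // A' BA'.
  have [//|A'A] := cmp A A' BA BA'.
  apply: contrapT => nAA'; apply: H; exists A'; split=> //; split => //.
by exists c.
Qed.

(** Without a maximal member there would be a strictly ascending sequence. Later this replaces
    induction on depth in the tree of members. *)
Lemma noetherian_max (T : Type) (C B : set (set T)) :
  noetherian C -> B `<=` C -> B !=set0 ->
  exists2 M, B M & forall A, B A -> M `<=` A -> A = M.
Proof.
move=> noeth BC [A0 BA0]; apply: contrapT => nmax.
have [|c [_ Bc cS]] := @dep_choice _ B (fun A A' => A `<` A') _ BA0.
  move=> A BA; apply: contrapT => H; apply: nmax; exists A => // A' BA' AA'.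
  apply: contrapT => neq; apply: H; exists A'; split=> //; split => // A'A.
  by apply: neq; apply/seteqP.
have [n /(_ n.+1 (leqnSn n)) E] := noeth c (fun n => BC _ (Bc n)) (fun n => proj1 (cS n)).
by have [_] := cS n; rewrite E; apply.
Qed.

Lemma crt_exit (V : Type) (R : V -> V -> Prop) (P : set V) x y :
  clos_refl_trans V R x y -> P x -> ~ P y ->
  exists u v, [/\ R u v, P u & ~ P v].
Proof.
elim=> [u v Ruv Pu nPv|u Pu /(_ Pu)//|u v w _ IH1 _ IH2 Pu nPw].
  by exists u, v.
by have [Pv|nPv] := pselect (P v); [exact: IH2|exact: IH1].
Qed.

(** * Connectivity and edge boundaries of vertex sets *)

Section Restriction.
Variables (V : Type) (E : V -> V -> Prop).
Hypothesis Esym : forall x y, E x y -> E y x.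

Definition restrict (S : set V) (x y : V) : Prop := [/\ E x y, S x & S y].

Definition conn (S : set V) : V -> V -> Prop := clos_refl_trans V (restrict S).

Definition connected_on (S : set V) : Prop := forall x y, S x -> S y -> conn S x y.

(** Cut edges are oriented from inside to outside, so each is counted once and [p.1] is its inner
    end. *)
Definition boundary (S : set V) : set (V * V) :=
  [set p | [/\ E p.1 p.2, S p.1 & ~ S p.2]].

Lemma conn_sym S x y : conn S x y -> conn S y x.
Proof.
elim=> [u v [Euv Su Sv]|u|u v w _ vu _ wv].
- by apply: rt_step; split=> //; exact: Esym.
- exact: rt_refl.
- exact: rt_trans wv vu.
Qed.

Lemma conn_in S x y : S x -> conn S x y -> S y.
Proof.
by move=> Sx xy; elim: xy Sx => [u v []|//|u v w _ IH1 _ IH2 /IH1/IH2].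
Qed.

Definition component (S : set V) (x : V) : set V := [set y | conn S x y].

Lemma component_sub S x : S x -> component S x `<=` S.
Proof. by move=> Sx y; exact: conn_in. Qed.

Lemma component_eq S x y : conn S x y -> component S x = component S y.
Proof.
move=> xy; apply/seteqP; split=> z; first exact: rt_trans (conn_sym xy).
exact: rt_trans.
Qed.

(** Every prefix of a path from [x] ends in the component of [x]; unrolling the closure from its
    last step exposes these prefixes. *)
Lemma component_connected S x : S x -> connected_on (component S x).
Proof.
move=> Sx; suff to_x y : conn S x y -> conn (component S x) x y.
  by move=> y z /to_x xy /to_x xz; apply: rt_trans (conn_sym xy) xz.
move=> H; have {H} := clos_rt_rtn1 _ _ _ _ H; elim=> [|u v [Euv Su Sv] xu IH].
  exact: rt_refl.
have {}xu := clos_rtn1_rt _ _ _ _ xu; apply: rt_trans IH _; apply: rt_step; split=> //.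
by apply: rt_trans xu _; exact: rt_step.
Qed.

Lemma bd_component S x : S x -> boundary (component S x) `<=` boundary S.
Proof.
move=> Sx [u v] [/= Euv xu nxv]; have Su := component_sub Sx xu.
split=> //= Sv; apply: nxv; apply: rt_trans xu _.
by apply: rt_step.
Qed.

Lemma bd_setC S : boundary (~` S) = (fun p => (p.2, p.1)) @` boundary S.
Proof.
apply/seteqP; split=> [[u v] [/= Euv nSu /contrapT Sv]|_ [[u v] [/= Euv Su nSv] <-]].
  by exists (v, u) => //; split=> //; exact: Esym.
by split=> //=; exact: Esym.
Qed.

Lemma bd_setI S S' : boundary (S `&` S') `<=` boundary S `|` boundary S'.
Proof.
move=> [u v] [/= Euv [Su S'u] n]; have [Sv|nSv] := pselect (S v); [right|by left].
by split=> //= S'v; exact: n.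
Qed.

Lemma finite_bd_setC S : finite_set (boundary S) -> finite_set (boundary (~` S)).
Proof. by rewrite bd_setC; exact: finite_image. Qed.

Lemma finite_bd_setI S S' :
  finite_set (boundary S) -> finite_set (boundary S') -> finite_set (boundary (S `&` S')).
Proof.
move=> fS fS'; apply: sub_finite_set (@bd_setI S S') _.
by rewrite finite_setU.
Qed.

Lemma finite_bd_setU S S' :
  finite_set (boundary S) -> finite_set (boundary S') -> finite_set (boundary (S `|` S')).
Proof.
move=> fS fS'; rewrite -[S]setCK -[S']setCK -setCI.
by apply: finite_bd_setC; apply: finite_bd_setI; exact: finite_bd_setC.
Qed.

Lemma finite_bd_setD S S' :
  finite_set (boundary S) -> finite_set (boundary S') -> finite_set (boundary (S `\` S')).
Proof. by move=> fS fS'; rewrite setDE; apply: finite_bd_setI => //; exact: finite_bd_setC. Qed.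

Lemma finite_bd_bigcup (I : Type) (F : set I) (f : I -> set V) :
  finite_set F -> (forall i, F i -> finite_set (boundary (f i))) ->
  finite_set (boundary (\bigcup_(i in F) f i)).
Proof.
move=> fF fin_bd; apply: (@sub_finite_set _ _ (\bigcup_(i in F) boundary (f i))).
  move=> [u v] [/= Euv [i Fi fu] nv]; exists i => //; split=> //= fv.
  by apply: nv; exists i.
exact: bigcup_finite.
Qed.

End Restriction.

(** * Disjoint finite cuts separating a root *)

Section Star.
Variables (V : Type) (E : V -> V -> Prop) (o : V).
Hypothesis Esym : forall x y, E x y -> E y x.

Local Notation bd := (boundary E).
Local Notation component := (component E).

(** Staying in the connected component of [o] forces every non-empty avoiding set to have a boundary
    edge, on a path to [o]. *)
Definition avoiding (B : set V) : Prop :=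
  [/\ B `<=` component setT o, ~ B o & finite_set (bd B)].

Definition separable (x : V) : Prop := exists2 B, avoiding B & B x.

Let K x := component separable x.

Lemma avoiding_sub_bd B B' : avoiding B -> B' `<=` B -> finite_set (bd B') ->
  avoiding B'.
Proof.
move=> [Bo nBo _] B'B fB'; split=> //; first exact: subset_trans B'B Bo.
by move=> /B'B.
Qed.

Lemma avoiding_bigcup (I : Type) (F : set I) (f : I -> set V) :
  finite_set F -> (forall i, F i -> avoiding (f i)) ->
  avoiding (\bigcup_(i in F) f i).
Proof.
move=> fF fa; split.
- by move=> x [i /fa[h _ _] /h].
- by move=> [i /fa[_ h _] /h].
- by apply: finite_bd_bigcup => // i /fa[].
Qed.

Lemma avoidingU B B' : avoiding B -> avoiding B' -> avoiding (B `|` B').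
Proof.
move=> [Bo nBo fB] [B'o nB'o fB']; split.
- by move=> x [/Bo|/B'o].
- by case.
- exact: finite_bd_setU.
Qed.

Lemma bd_cap_K B x : avoiding B -> bd (B `&` K x) `<=` bd B.
Proof.
move=> IB [u v] [/= Euv [Bu Ku] n]; split=> //= Bv; apply: n; split=> //.
by apply: rt_trans Ku _; apply: rt_step; split=> //; exists B.
Qed.

Lemma avoiding_cap_K B x : avoiding B -> avoiding (B `&` K x).
Proof.
move=> IB; apply: (avoiding_sub_bd IB) => [|]; first exact: subIsetl.
by apply: sub_finite_set (@bd_cap_K B x IB) _; case: IB.
Qed.

Lemma avoiding_exit B z : B z -> avoiding B -> forall P : set V, P z -> ~ P o ->
  exists u v, [/\ E u v, P u & ~ P v].
Proof.
move=> Bz [/(_ _ Bz) oz _ _] P Pz nPo.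
have [u [v [[Euv _ _] Pu nPv]]] := crt_exit (conn_sym Esym oz) Pz nPo.
by exists u, v.
Qed.

(** A path to [o] from a point of [B] outside [B'] leaves this difference by an edge that either
    leaves [B] or stays in [B] and enters [B']. In each case the edge is in one boundary with an
    orientation impossible in the other. *)
Lemma avoiding_inj B B' : avoiding B -> avoiding B' -> bd B = bd B' -> B `<=` B'.
Proof.
move=> IB [_ nB'o _] bdE z Bz; apply: contrapT => nB'z.
have [||u [v [Euv [Bu nB'u] n]]] := avoiding_exit Bz IB (P := B `\` B').
- by split.
- by move=> [Bo _]; case: IB => _ /(_ Bo).
have [Bv|nBv] := pselect (B v); last first.
  by have : bd B (u, v) by []; rewrite bdE => -[].
have B'v : B' v by apply: contrapT => nB'v; apply: n.
have : bd B' (v, u) by split=> //; exact: Esym.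
by rewrite -bdE => -[_ _ /(_ Bu)].
Qed.

(* The vertices of K x are covered by countably many avoiding sets A u: each
   has only finitely many outer neighbours, and adding the sets of these
   neighbours repeatedly exhausts K x.  Every avoiding subset of K x is
   contained in one whose boundary consists of the countably many boundary edges
   of the sets A u, and an avoiding set is determined by its boundary. *)
Lemma countable_cofinality x : separable x ->
  exists2 C : nat -> set V, forall n, avoiding (C n) /\ C n `<=` K x &
    forall B, avoiding B -> exists n, B `&` K x `<=` C n.
Proof.
move=> sx.
have /choice[A AP] : forall y, exists B, separable y -> avoiding B /\ B y.
  move=> y; have [[B IB By]|ns] := pselect (separable y).
    by exists B.
  by exists set0.
pose fix N n := if n is n'.+1 then
  \bigcup_(u in N n') ((snd @` bd (A u)) `&` separable) else [set x].
have N_sep n u : N n u -> separable u.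
  by case: n => [->|n [w _ []]].
have N_count n : countable (N n).
  elim: n => [|n IH]; first exact/finite_set_countable/finite_set1.
  apply: bigcup_countable => // u /N_sep/AP[[_ _ fA] _].
  apply/finite_set_countable; apply: finite_setIl; exact: finite_image.
pose W := \bigcup_n N n.
have W_count : countable W by exact: bigcup_countable.
have W_sep u : W u -> separable u by move=> [n _ /N_sep].
have cover y : K x y -> exists u, W u /\ A u y.
  move=> Kxy; apply: contrapT => nP.
  have [|a [b [[Eab _ sb] [u [[n _ Nu] Aua]] nPb]]] :=
    crt_exit (P := [set y | exists u, W u /\ A u y]) Kxy _ nP.
    by exists x; split; [exists 0 | case: (AP x sx)].
  have [Aub|nAub] := pselect (A u b).
    by apply: nPb; exists u; split=> //; exists n.
  apply: nPb; exists b; split; last by case: (AP b sb).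
  by exists n.+1 => //; exists u => //; split=> //; exists (a, b).
have /choice[h hP] : forall y, exists u, K x y -> W u /\ A u y.
  move=> y; have [Ky|nKy] := pselect (K x y); last by exists x.
  by have [u] := cover y Ky; exists u.
pose E' := \bigcup_(u in W) bd (A u).
have E'_count : countable E'.
  apply: bigcup_countable => // u /W_sep/AP[[_ _ fA] _].
  exact: finite_set_countable.
have [code codeI] := countable_injP _ E'_count.
pose Fam C := [/\ avoiding C, C `<=` K x & bd C `<=` E'].
have Fam0 : Fam set0.
  have bd0 : bd set0 = set0 by apply/seteqP; split=> p // [].
  by split=> //; rewrite ?bd0 //; split=> //; rewrite bd0.
(* By [avoiding_inj] a list of boundary codes names at most one member of [Fam]; [dec] returns it,
   or [set0] when the list names none. *)
have /choice[dec decP] : forall l : seq nat, exists C', Fam C' /\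
    forall C, Fam C -> (forall p, bd C p <-> E' p /\ code p \in l) ->
      C `<=` C'.
  move=> l.
  have [[C [FC CP]]|nC] := pselect (exists C, Fam C /\
      forall p, bd C p <-> E' p /\ code p \in l).
    exists C; split=> // C' FC' C'P; apply: avoiding_inj; [by case: FC'|by case: FC|].
    by apply/seteqP; split=> p; [move=> /C'P/CP|move=> /CP/C'P].
  by exists set0; split=> // C FC CP; case: nC; exists C.
exists (fun n => oapp dec set0 (unpickle n)).
  by move=> n; case: unpickle => [l|]; [have [[]] := decP l | have [] := Fam0].
move=> B IB.
(* Adding [A (h p.1)] around the inner end of every boundary edge [p] leaves only boundary edges of
   the sets [A u], which lie in [E']. *)
pose Bp := (B `&` K x) `|` \bigcup_(p in bd (B `&` K x)) (A (h p.1) `&` K x).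
have Bp_av : avoiding Bp.
  apply: avoidingU; first exact: avoiding_cap_K.
  apply: avoiding_bigcup; first by case: (avoiding_cap_K x IB).
  move=> [u v] [/= _ [_ /hP[/W_sep/AP[IA _] _]] _]; exact: avoiding_cap_K.
have Bp_Fam : Fam Bp.
  split=> //; first by move=> y [[]|[p _ []]].
  have inA u v w : W w -> E u v -> K x u -> A w u -> ~ (A w `&` K x) v -> E' (u, v).
    move=> Ww Euv Ku Awu nv; exists w => //; split=> //= Awv; apply: nv; split=> //.
    apply: rt_trans Ku _; apply: rt_step; have [IA _] := AP w (W_sep w Ww).
    by split=> //; exists (A w).
  move=> [u v] [/= Euv [[Bu Ku]|[p pbd [Au Ku]]] nv].
    have uv_bd : bd (B `&` K x) (u, v) by split=> //= Bv; apply: nv; left.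
    have [Wh Ahu] := hP u Ku; apply: (inA _ _ (h u)) => // Av; apply: nv; right.
    by exists (u, v).
  have Kp1 : K x p.1 by case: pbd => _ [].
  have [Wh _] := hP p.1 Kp1; apply: (inA _ _ (h p.1)) => // Av; apply: nv; right.
  by exists p.
have [l lE] : exists l : seq nat, code @` bd Bp = [set` l].
  by apply/finite_seqP; apply: finite_image; case: Bp_av.
exists (pickle l); rewrite pickleK => y By.
have [_ ] := decP l; apply; [exact: Bp_Fam| |by left].
move=> p; split=> [bp|[E'p pl]].
  split; first by have [_ _] := Bp_Fam; apply.
  by have : (code @` bd Bp) (code p) by [exists p]; rewrite lE.
have : [set` l] (code p) by [].
rewrite -lE => -[q bq /codeI <- //]; rewrite inE //.
by have [_ _] := Bp_Fam; apply.
Qed.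

(** Every component has a boundary edge, which is also one of [S]; hence sending a boundary edge of
    [S] to the component of its inner end reaches all components. *)
Lemma finite_components S : avoiding S -> finite_set [set component S x | x in S].
Proof.
move=> IS; have [_ nSo fS] := IS.
apply: (@sub_finite_set _ _ ((fun p => component S p.1) @` bd S)); last exact: finite_image.
move=> _ [x Sx <-].
have [||u [v [Euv xu nxv]]] := avoiding_exit Sx IS (P := component S x).
- exact: rt_refl.
- by move=> xo; apply: nSo; exact: component_sub xo.
exists (u, v); last by rewrite /= (component_eq Esym xu).
by apply: (bd_component Sx).
Qed.

(** In each [K x] the sets of a cofinal sequence are made disjoint by removing the earlier ones, and
    the family consists of the connected components of the differences [D]. An avoiding [B] has a
    boundary edge in every [K x] that it meets, so it meets finitely many of them, and inside each
    it meets only differences of bounded index. *)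
Lemma star : exists SS : set (set V),
  [/\ forall S, SS S -> [/\ avoiding S, S !=set0 & connected_on E S],
      forall S S', SS S -> SS S' -> S `&` S' !=set0 -> S = S' &
      forall B, avoiding B -> B `<=` \bigcup_(S in SS) S /\
        finite_set [set S | SS S /\ S `&` B !=set0] ].
Proof.
(* The sequence is chosen for the set [k] and not for the vertex [x], so that vertices with the same
   [K x] share it. *)
have /choice[C CP] : forall k, exists C : nat -> set V,
    (exists2 x, separable x & k = K x) ->
    (forall n, avoiding (C n) /\ C n `<=` k) /\
    forall B, avoiding B -> exists n, B `&` k `<=` C n.
  move=> k; have [[x sx ->]|n] := pselect (exists2 x, separable x & k = K x).
    by have [c c1 c2] := countable_cofinality sx; exists c.
  by exists (fun _ => set0).
have {}CP x : separable x -> (forall n, avoiding (C (K x) n) /\ C (K x) n `<=` K x) /\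
    forall B, avoiding B -> exists n, B `&` K x `<=` C (K x) n.
  by move=> sx; apply: CP; exists x.
pose D k n := C k n `\` \bigcup_(j in `I_n) C k j.
have DC x n : separable x -> avoiding (D (K x) n) /\ D (K x) n `<=` K x.
  move=> /CP[/[dup] Cav /(_ n)[CI CK] _]; split; last by move=> y [/CK].
  apply: (avoiding_sub_bd CI (@subDsetl _ _ _)).
  apply: finite_bd_setD => //; first by case: (Cav n) => -[].
  by apply: finite_bd_bigcup; [exact: finite_II | move=> j _; case: (Cav j) => -[]].
have Dcover x n y : separable x -> C (K x) n y -> exists2 m, m <= n & D (K x) m y.
  move=> sx Cy; have ex : exists m, `[< C (K x) m y >] by exists n; apply/asboolP.
  case: (ex_minnP ex) => m /asboolP Cm min; exists m; first by apply/min/asboolP.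
  by split=> // -[j /= jm /asboolP/min]; rewrite leqNgt jm.
pose SS S := exists x n y, [/\ separable x, D (K x) n y & S = component (D (K x) n) y].
have Keq x y : K x y -> K x = K y by move=> xy; exact: component_eq.
exists SS; split.
- move=> _ [x [n [y [sx Dy ->]]]]; have [DI DK] := DC x n sx; split.
  + apply: (avoiding_sub_bd DI (@component_sub _ _ _ _ Dy)).
    by apply: sub_finite_set (bd_component Dy) _; case: DI.
  + by exists y; exact: rt_refl.
  + exact: component_connected.
- move=> _ _ [x [n [y [sx Dy ->]]]] [x' [n' [y' [sx' Dy' ->]]]] [z [yz y'z]].
  have Dz := component_sub Dy yz; have D'z := component_sub Dy' y'z.
  have [_ /(_ _ Dz) Kxz] := DC x n sx; have [_ /(_ _ D'z) Kx'z] := DC x' n' sx'.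
  have KE : K x = K x' by rewrite (Keq x z) // (Keq x' z).
  have nE : n = n'.
    rewrite KE in Dz; case: Dz D'z => [Cz nz] [Cz' nz'].
    case: (ltngtP n n') => // lt; first by case: nz'; exists n.
    by case: nz; exists n'.
  by rewrite -nE -KE in y'z *; rewrite (component_eq Esym yz) (component_eq Esym y'z).
- move=> B IB; split.
    move=> z Bz; have sz : separable z by exists B.
    have [_ /(_ B IB)[n BC]] := CP z sz.
    have [|m _ Dz] := Dcover z n z sz; first by apply: BC; split=> //; exact: rt_refl.
    by exists (component (D (K z) m) z); [exists z, m, z | exact: rt_refl].
  have /choice[b bP] : forall x, exists n, separable x -> B `&` K x `<=` C (K x) n.
    move=> x; have [sx|ns] := pselect (separable x); last by exists 0.
    by have [_ /(_ B IB)[n]] := CP x sx; exists n.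
  (* A member meeting [B] is recorded by a boundary edge of [B] in the same [K x], an index at most
     [b p.1], and a component of that difference. *)
  apply: (@sub_finite_set _ _ (\bigcup_(p in bd B) \bigcup_(n in `I_(b p.1).+1)
    [set component (D (K p.1) n) y | y in D (K p.1) n])); last first.
    apply: bigcup_finite; first by case: IB.
    move=> [u v] [/= Euv Bu nBv]; apply: bigcup_finite; first exact: finite_II.
    by move=> n _; apply: finite_components; apply: (proj1 (DC u n _)); exists B.
  move=> S [[x [n [y [sx Dy SE]]]] [z [Sz Bz]]].
  have Dz : D (K x) n z by rewrite SE in Sz; exact: component_sub Sz.
  have [_ /(_ _ Dz) Kxz] := DC x n sx.
  have [||u [v [Euv [Bu Ku] nv]]] := avoiding_exit Bz IB (P := B `&` K x).
  + by split.
  + by move=> [Bo _]; case: IB => _ /(_ Bo).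
  have uv_bd : bd B (u, v) by apply: (@bd_cap_K B x).
  have su : separable u by exists B.
  exists (u, v) => //; exists n => /=; last by rewrite -(Keq x u) //; exists y.
  rewrite ltnS leqNgt; apply/negP => bn; case: Dz => _; apply.
  by exists (b u) => //; rewrite (Keq x u) //; apply: bP => //; rewrite -(Keq x u).
Qed.

End Star.

(** * Edge-ends and finite cuts *)

Section Ends.
Variable G : graph.
Implicit Types (A D : set G) (r s t : ray G) (e : edge_end G).

Local Notation bd := (boundary (@adj G)).
Local Notation connected_on := (connected_on (@adj G)).

Lemma adj_sym (u v : G) : adj u v -> adj v u.
Proof. by rewrite /adj setUC. Qed.

Definition fin_bd D : Prop := finite_set (bd D).

Definition eventually_in r D : Prop := exists k, forall n, k <= n -> D (r n).

Definition edge_set (P : set (G * G)) : set (set G) :=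
  [set [set p.1; p.2] | p in P].

Lemma fin_bd_setC D : fin_bd D -> fin_bd (~` D).
Proof. exact: finite_bd_setC adj_sym _. Qed.

Lemma finite_edge_set_bd D : fin_bd D -> finite_edge_set (edge_set (bd D)).
Proof. by move=> fD; split; [exact: finite_image | move=> _ [p [pE _ _] <-]]. Qed.

Lemma linked_bd D (u v : G) : D u -> @linked (del_edges (edge_set (bd D))) u v -> D v.
Proof.
move=> Du uv; apply: contrapT => nDv.
have [x [y [[xy nF] Dx nDy]]] := crt_exit uv Du nDv.
by apply: nF; exists (x, y).
Qed.

(** Past some index the ray avoids the finitely many boundary edges of [D], so it no longer changes
    sides. *)
Lemma eventually_or r D : fin_bd D -> eventually_in r D \/ eventually_in r (~` D).
Proof.
move=> /[dup] fD /finite_edge_set_bd[fF _].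
have [k kF] := ray_avoids r fF.
have step n : (D (r (k + n)) -> D (r (k + n).+1)) /\ (D (r (k + n).+1) -> D (r (k + n))).
  split=> Dr; apply: contrapT => nD; apply: (kF n).
    by exists (r (k + n), r (k + n).+1) => //; split=> //=; exact: ray_adj.
  exists (r (k + n).+1, r (k + n)) => /=; last by rewrite setUC.
  by split=> //=; apply: adj_sym; exact: ray_adj.
have [Dk|nDk] := pselect (D (r k)); [left|right]; exists k => n /subnKC <-.
  by elim: (n - k) => [|m IH]; rewrite ?addn0 // addnS; case: (step m) => + _; exact.
elim: (n - k) => [|m IH]; rewrite ?addn0 // addnS => Dm; apply: IH.
by case: (step m) => _; exact.
Qed.

Lemma eventuallyI r D D' : eventually_in r D -> eventually_in r D' ->
  eventually_in r (D `&` D').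
Proof.
move=> [k kD] [k' kD']; exists (maxn k k') => n; rewrite geq_max => /andP[? ?].
by split; [exact: kD | exact: kD'].
Qed.

Lemma eventually_sub r D D' : D `<=` D' -> eventually_in r D -> eventually_in r D'.
Proof. by move=> DD' [k kD]; exists k => n /kD/DD'. Qed.

Lemma eventually_meet r D D' : eventually_in r D -> eventually_in r D' ->
  D `&` D' !=set0.
Proof. by move=> rD rD'; have [k kI] := eventuallyI rD rD'; exists (r k); exact: kI. Qed.

Lemma eventually_notC r D : eventually_in r D -> ~ eventually_in r (~` D).
Proof. by move=> rD /(eventually_meet rD)[x []]. Qed.

Lemma tail_eventually r t D : tail t r -> fin_bd D ->
  (eventually_in r D <-> eventually_in t D).
Proof.
move=> /tailP[k tk] fD.
have imp A : eventually_in r A -> eventually_in t A.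
  move=> [m mA]; exists m => n mn; rewrite tk; apply: mA.
  by apply: leq_trans mn _; rewrite leq_addl.
split=> [|tD]; first exact: imp.
by have [//|/imp/(eventually_notC tD)] := eventually_or r fD.
Qed.

(** Forwards, the boundary of [D] is deleted. Backwards, a component of the graph without [F] has
    all its boundary edges in [F], hence has finite boundary. *)
Lemma edge_equivP r s :
  edge_equiv r s <-> forall D, fin_bd D -> eventually_in r D -> eventually_in s D.
Proof.
split=> [rs D fD rD|H F [fF FE]].
  have [_ [[v ->] [t tr [tC _]] [t' t's [t'C _]]]] := rs _ (finite_edge_set_bd fD).
  have [k tD] : eventually_in t D by apply/(tail_eventually tr fD).
  have {tD} Dt := tD k (leqnn k).
  have vt := tC (t k) (ex_intro2 _ _ k I erefl).
  apply/(tail_eventually t's fD); exists 0 => n _.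
  have vt' := t'C (t' n) (ex_intro2 _ _ n I erefl).
  apply: (linked_bd Dt); exact: rt_trans (linked_sym vt) vt'.
have [C [cC [t tr tC]]] := ray_has_component r fF.
have CF u v : C u -> adj u v -> ~ F [set u; v] -> C v.
  case: cC => w -> wu uv nF; apply: rt_trans wu _; exact: rt_step.
have Cfb : fin_bd C.
  apply: (@sub_finite_set _ _ ((fun p => [set p.1; p.2]) @^-1` F `&` bd C)).
    move=> [u v] bC; split=> //=; apply: contrapT => nF; case: bC => /= uv Cu; apply.
    exact: CF nF.
  (* An edge of [F] yields at most one boundary pair, since its end in [C] must come first. *)
  apply: (@sub_finite_set _ _ (\bigcup_(a in F) [set p | a = [set p.1; p.2] /\ bd C p])).
    by move=> p [Fp bp]; exists [set p.1; p.2].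
  apply: bigcup_finite => // a Fa.
  have [[p [aE bp]]|n] := pselect (exists p, a = [set p.1; p.2] /\ bd C p); last first.
    by apply: (@sub_finite_set _ _ set0); [move=> p h; case: n; exists p|].
  apply: (@sub_finite_set _ _ [set p]); last exact: finite_set1.
  move=> q [qE bq]; rewrite aE in qE; have := Defs.pair_eqE qE.
  case: p q bp bq {aE qE} => u v [u' v'] [/= _ Cu nCv] [/= _ Cu' nCv'].
  by move=> [[-> ->]|[uv' _]] //; case: nCv'; rewrite -uv'.
have rC : eventually_in r C.
  by apply/(tail_eventually tr Cfb); exists 0 => n _; apply: (proj1 tC); exists n.
have [m sC] := H C Cfb rC.
have [k kF] := ray_avoids s fF.
exists C; split=> //; first by exists t.
exists (shift s (k + m)); first exact: shift_tail.
split=> [_ [n _ <-] /=|_ [n _ <-] /=].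
  by apply: sC; rewrite -addnA addnCA leq_addr.
by split; [rewrite addnS; exact: ray_adj | rewrite addnS -addnA; exact: kF].
Qed.

Lemma edge_equiv_sym r s : edge_equiv r s -> edge_equiv s r.
Proof.
move=> /edge_equivP H; apply/edge_equivP => D fD sD.
have [//|/H] := eventually_or r fD.
by move=> /(_ (fin_bd_setC fD))/(eventually_notC sD).
Qed.

Lemma edge_class_eq r s : edge_equiv r s -> edge_class r = edge_class s.
Proof.
move=> rs; have sr := edge_equiv_sym rs; have trans (a b c : ray G) :
    edge_equiv a b -> edge_equiv b c -> edge_equiv a c.
  move=> /edge_equivP ab /edge_equivP bc; apply/edge_equivP => D fD aD.
  by apply: bc => //; exact: ab.
by apply/seteqP; split=> t /=; exact: trans.
Qed.

Definition end_of r : edge_end G := EdgeEnd (ex_intro _ r (erefl (edge_class r))).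

Lemma edge_end_ext e e' : end_class e = end_class e' -> e = e'.
Proof.
case: e e' => c h [c' h'] /= E; case: _ / E h' => h'.
by congr EdgeEnd; exact: Prop_irrelevance.
Qed.

Lemma end_ofP e : exists r, e = end_of r.
Proof. by have [r er] := end_classP e; exists r; exact: edge_end_ext. Qed.

(** When [D] has finite boundary, the choice of the ray is immaterial by [lives_end_of]. *)
Definition lives e D : Prop := exists2 r, end_class e r & eventually_in r D.

Lemma lives_end_of r D : fin_bd D -> lives (end_of r) D <-> eventually_in r D.
Proof.
move=> fD; split=> [[s /= /edge_equiv_sym/edge_equivP rs sD]|rD]; first exact: rs.
by exists r => //; exact: edge_equiv_refl.
Qed.

Lemma livesC e D : fin_bd D -> lives e (~` D) <-> ~ lives e D.
Proof.
have [r ->] := end_ofP e => fD; rewrite !lives_end_of //; last exact: fin_bd_setC.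
split=> [rC rD|nD]; first exact: eventually_notC rC.
by have [] := eventually_or r fD.
Qed.

Lemma livesI e D D' : fin_bd D -> fin_bd D' -> lives e D -> lives e D' -> lives e (D `&` D').
Proof.
have [r ->] := end_ofP e => fD fD'; rewrite !lives_end_of //; last exact: finite_bd_setI.
exact: eventuallyI.
Qed.

Lemma lives_sub e D D' : D `<=` D' -> lives e D -> lives e D'.
Proof. by move=> DD' [r er rD]; exists r => //; exact: eventually_sub rD. Qed.

Lemma lives_meet e D D' : fin_bd D -> fin_bd D' -> lives e D -> lives e D' -> D `&` D' !=set0.
Proof.
by move=> fD fD' eD /(livesI fD fD' eD)[r _ [k kI]]; exists (r k); exact: kI.
Qed.

Lemma lives_ex e D : lives e D -> D !=set0.
Proof. by move=> [r _ [k kD]]; exists (r k); exact: kD. Qed.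

Lemma lives_bigcup (I : Type) (F : set I) (f : I -> set G) e :
  finite_set F -> (forall i, F i -> fin_bd (f i)) -> lives e (\bigcup_(i in F) f i) ->
  exists2 i, F i & lives e (f i).
Proof.
have [r ->] := end_ofP e => fF fb_f; rewrite lives_end_of; last exact: finite_bd_bigcup.
move=> rU; apply: contrapT => n.
have /choice[b bP] : forall i, exists k, F i -> forall m, k <= m -> ~ f i (r m).
  move=> i; have [Fi|nFi] := pselect (F i); last by exists 0.
  have [ri|[k kC]] := eventually_or r (fb_f i Fi); last by exists k.
  by case: n; exists i => //; apply/lives_end_of => //; exact: fb_f.
have [k kb] : exists k, forall i, F i -> b i <= k.
  have /finite_seqP[l lE] : finite_set (b @` F) by exact: finite_image.
  exists (\max_(j <- l) j) => i Fi; have : (b @` F) (b i) by exists i.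
  by rewrite lE => il; exact: (@leq_bigmax_seq _ l predT id _ il isT).
case: rU => m mU; have [i Fi] := mU (maxn k m) (leq_maxr _ _).
by apply: (bP i Fi); rewrite leq_max kb.
Qed.

Lemma edge_end_eq e e' : (forall D, fin_bd D -> lives e D -> lives e' D) -> e = e'.
Proof.
have [r ->] := end_ofP e; have [s ->] := end_ofP e' => H.
apply: edge_end_ext; apply: edge_class_eq; apply/edge_equivP => D fD rD.
by apply/lives_end_of => //; apply: H => //; apply/lives_end_of.
Qed.

(** Components after deleting a finite edge set have finite boundary; conversely, deleting the
    boundary of [A] confines to [A] every end in the resulting neighbourhood of [e]. *)
Lemma edge_end_openP (U : set (edge_end G)) : open U <->
  forall e, U e -> exists A, [/\ fin_bd A, lives e A & forall e', lives e' A -> U e'].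
Proof.
have -> : open U = end_open U by [].
split=> H e Ue.
  have [F fF FU] := H e Ue.
  have [cC [r [t [er tr tC]]]] := end_componentP e (proj1 fF).
  have fC : fin_bd (end_component F e).
    have CF u v : end_component F e u -> adj u v -> ~ F [set u; v] -> end_component F e v.
      case: cC => w -> wu uv nF; apply: rt_trans wu _; exact: rt_step.
    have H' : edge_set (bd (end_component F e)) `<=` F.
      move=> _ [[u v] [/= uv Cu nCv] <-]; apply: contrapT => nF; apply: nCv; exact: CF nF.
    apply: (@sub_finite_set _ _ (\bigcup_(a in F) [set p | a = [set p.1; p.2]])).
      by move=> p bp; exists [set p.1; p.2] => //; apply: H'; exists p.
    apply: bigcup_finite; first by case: fF.
    move=> a Fa; have [u [v [_ aE]]] := edgesP ((proj2 fF) a Fa).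
    apply: (@sub_finite_set _ _ [set (u, v); (v, u)]).
      move=> [x y] /=; rewrite aE => xyE.
      by have [[-> ->]|[-> ->]] := Defs.pair_eqE xyE; [left|right].
    by rewrite finite_setU; split; exact: finite_set1.
  exists (end_component F e); split=> //.
    exists r => //; apply/(tail_eventually tr fC); exists 0 => n _.
    by apply: (proj1 tC); exists n.
  move=> e' [s es [m sC]]; apply: FU; apply: end_component_eq => //; split=> //.
  have [k kF] := ray_avoids s (proj1 fF).
  exists s, (shift s (k + m)); split=> //; first exact: shift_tail.
  split=> [_ [n _ <-] /=|_ [n _ <-] /=].
    by apply: sC; rewrite -addnA addnCA leq_addr.
  by split; [rewrite addnS; exact: ray_adj | rewrite addnS -addnA; exact: kF].
have [A [fA [r er [k rA]] AU]] := H e Ue.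
exists (edge_set (bd A)); first exact: finite_edge_set_bd.
move=> e' e'e; apply: AU.
have fF := finite_edge_set_bd fA.
have [_ [s [t [es ts [tC _]]]]] := end_componentP e' (proj1 fF).
have [cC [r' [t' [er' t'r' [t'C _]]]]] := end_componentP e (proj1 fF).
exists s => //; apply/(tail_eventually ts fA).
have [r0 e0] := end_classP e; rewrite e0 in er er'.
have [m t'A] : eventually_in t' A.
  apply/(tail_eventually t'r' fA); move/edge_equivP: er'; apply=> //.
  by move/edge_equiv_sym/edge_equivP: er; apply=> //; exists k.
exists 0 => n _; apply: (linked_bd (t'A m (leqnn m))).
rewrite e'e in tC; case: cC => v E; rewrite E in tC t'C.
have vt' := t'C (t' m) (ex_intro2 _ _ m I erefl).
have vt := tC (t n) (ex_intro2 _ _ n I erefl).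
exact: rt_trans (linked_sym vt') vt.
Qed.

Lemma connected_cut D A : connected_on D -> (forall p, bd A p -> ~ D p.1) ->
  D `&` A !=set0 -> D `<=` A.
Proof.
move=> cD nbd [x [Dx Ax]] y Dy; apply: contrapT => nAy.
have [u [v [[uv Du _] Au nAv]]] := crt_exit (cD x y Dx Dy) Ax nAy.
by apply: (nbd (u, v)).
Qed.

(** * Descending connected vertex sets with empty intersection *)

Section Descending.
Variable c : nat -> set G.
Hypotheses (c_sub : forall n, c n.+1 `<=` c n) (c_conn : forall n, connected_on (c n))
  (c_cap : \bigcap_n c n = set0).

Lemma descending_out v : exists n, ~ c n v.
Proof.
apply: contrapT => H; have : (\bigcap_n c n) v.
  by move=> n _; apply: contrapT => nv; apply: H; exists n.
by rewrite c_cap.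
Qed.

(** For large [n] the inner ends of the finitely many boundary edges of [A] are all outside [c n],
    so no path inside [c n] can leave [A]. *)
Lemma descending_cut A : fin_bd A -> exists n, c n `&` A !=set0 -> c n `<=` A.
Proof.
move=> fA; have /choice[f fP] := descending_out.
have /finite_seqP[l lE] : finite_set ((fun p => f p.1) @` bd A) by exact: finite_image.
exists (\max_(j <- l) j); apply: connected_cut => // p bp.
move=> cp; apply: (fP p.1); apply: descending_le cp => //.
have : ((fun p => f p.1) @` bd A) (f p.1) by exists p.
by rewrite lE => il; exact: (@leq_bigmax_seq _ l predT id _ il isT).
Qed.

(* A step from v stays in the last c n containing v and decreases the distance
   to c n.+1, so that no vertex is visited twice. *)
Lemma descending_ray : (forall n, c n !=set0) ->
  exists r : ray G, forall n, eventually_in r (c n).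
Proof.
move=> c_ne.
have lev_ex v : c 0 v -> exists n, c n v /\ ~ c n.+1 v.
  move=> c0; have ex : exists n, ~~ `[< c n v >].
    by have [n nv] := descending_out v; exists n; apply/asboolPn.
  case: (ex_minnP ex) => -[/asboolPn//|n /asboolPn nv min]; exists n; split=> //.
  by apply/asboolP; apply: contraT => /min; rewrite ltnn.
have /choice[lev levP] : forall v, exists n, c 0 v -> c n v /\ ~ c n.+1 v.
  by move=> v; have [/lev_ex[n]|] := pselect (c 0 v); [exists n | exists 0].
(* [near n k v] expresses a walk of length [k] inside [c n] from [v] into [c n.+1]. *)
pose fix near (n k : nat) (v : G) {struct k} : Prop := if k is k'.+1 then
  exists w, [/\ adj v w, c n v, c n w & near n k' w] else c n.+1 v.
have near_ex n v : c n v -> exists k, near n k v.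
  move=> cv; have [w cw] := c_ne n.+1.
  have := c_conn cv (c_sub cw); move/(clos_rt_rt1n _ _ _ _) => vw.
  elim: vw cw {cv} => [x cx|x y z [xy cx cy] _ IH cz]; first by exists 0.
  by have [k ky] := IH cz; exists k.+1; exists y.
have /choice[dist distP] : forall v, exists k, c 0 v ->
    near (lev v) k v /\ forall j, near (lev v) j v -> k <= j.
  move=> v; have [c0|] := pselect (c 0 v); last by exists 0.
  have [cv _] := levP v c0.
  have ex : exists k, `[< near (lev v) k v >].
    by have [k] := near_ex _ v cv; exists k; apply/asboolP.
  by case: (ex_minnP ex) => k /asboolP kP min; exists k => _; split=> // j /asboolP/min.
pose better v w := lev v < lev w \/ lev v = lev w /\ dist w < dist v.
have lev_le n v : c 0 v -> c n v -> n <= lev v.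
  move=> /levP[_ nv] cv; rewrite leqNgt; apply/negP => lt; apply: nv.
  exact: descending_le cv.
have next v : c 0 v -> exists w, c 0 w /\ (adj v w /\ better v w).
  move=> c0; have [cv ncv] := levP v c0; have [kP min] := distP v c0.
  case E : (dist v) kP => [|k] //= [w [vw _ cw wk]].
  have c0w : c 0 w by apply: descending_le cw.
  exists w; split=> //; split=> //; have := lev_le _ _ c0w cw.
  rewrite leq_eqVlt => /orP[/eqP lE|]; last by left.
  right; split=> //; rewrite E ltnS.
  by have [_] := distP w c0w; apply; rewrite -lE.
have [v0 c0] := c_ne 0.
have [r [_ rc rS]] := dep_choice c0 next.
have better_lt i j : i < j -> better (r i) (r j).
  move=> /subnKC <-; elim: (j - i.+1) => [|m IH]; first by rewrite addn0; case: (rS i).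
  rewrite addnS; have [_] := rS (i.+1 + m); move: IH; rewrite /better.
  move=> [a|[-> a]] [b|[<- b]]; [left|left|left|right].
  - exact: ltn_trans b.
  - by [].
  - by [].
  - by split=> //; exact: ltn_trans a.
have r_inj : injective r.
  have irr v : ~ better v v by case=> [|[_]]; rewrite ltnn.
  move=> i j rE; case: (ltngtP i j) => // /better_lt; rewrite rE => /irr //.
have r_adj n : adj (r n) (r n.+1) by case: (rS n).
exists (Ray r_inj r_adj) => n /=.
suff [k kn] : exists k, n <= lev (r k).
  exists k => m; rewrite leq_eqVlt => /orP[/eqP <-|km].
    by apply: descending_le kn _ _ => //; case: (levP _ (rc k)).
  apply: (descending_le c_sub) (proj1 (levP _ (rc m))).
  by apply: leq_trans kn _; case: (better_lt _ _ km) => [/ltnW|[-> _]].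
elim: n => [|n [k kn]]; first by exists 0.
(* As long as the level does not rise, the distance drops; induction on a bound for the distance
   therefore reaches the next level. *)
have [d dE] : exists d, dist (r k) <= d by exists (dist (r k)).
elim: d k dE kn => [|d IH] k kd kn.
  have [_ [lt|[_]]] := rS k; first by exists k.+1; exact: leq_ltn_trans lt.
  by move=> lt; have := leq_trans lt kd.
have [_ [lt|[lE lt]]] := rS k; first by exists k.+1; exact: leq_ltn_trans lt.
by apply: (IH k.+1); [rewrite -ltnS; exact: leq_trans lt kd | rewrite -lE].
Qed.

End Descending.
End Ends.

(** * Trees of finite cuts *)

(** The interface shared by both directions: it holds for the tree grown in a graph and for the
    cones of the graph of a tree of sets. The last field describes neighbourhoods of an end hosted
    by a least member. *)
Record cut_tree (G : graph) (T : set (set G)) : Prop := CutTree {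
  cut_tree_fin_bd : forall D, T D -> fin_bd D;
  cut_tree_connected : forall D, T D -> connected_on (@adj G) D;
  cut_tree_nested : nested T;
  cut_tree_cap : forall c : nat -> set G, (forall n, T (c n)) ->
    (forall n, c n.+1 `<` c n) -> \bigcap_n c n = set0;
  cut_tree_cover : forall e : edge_end G, exists2 D, T D & lives e D;
  cut_tree_least : forall (e : edge_end G) D A, T D -> lives e D ->
    (forall D', T D' -> lives e D' -> D `<=` D') -> fin_bd A -> lives e A ->
    exists FF, [/\ finite_set FF, FF `<=` T, forall D', FF D' -> ~ lives e D' &
      D `\` \bigcup_(D' in FF) D' `<=` A]
}.

Section CutTree.
Variables (G : graph) (T : set (set G)).
Hypothesis T_tree : cut_tree T.

(** If the members hosting [e] have a least one, [cut_tree_least] applies. Otherwise they contain a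
    descending sequence, one of whose sets lies in [A] by [descending_cut], and [FF] is empty. *)
Lemma cut_tree_nbhd (e : edge_end G) A : fin_bd A -> lives e A ->
  exists D FF, [/\ T D /\ lives e D, finite_set FF, FF `<=` T,
    forall D', FF D' -> ~ lives e D' &
    forall e', lives e' D -> (forall D', FF D' -> ~ lives e' D') -> lives e' A].
Proof.
move=> fA eA; pose B := [set D | T D /\ lives e D].
suff [D [FF [TD eD [fFF FT nFF sub]]]] : exists D FF, [/\ T D, lives e D &
    [/\ finite_set FF, FF `<=` T, forall D', FF D' -> ~ lives e D' &
      D `\` \bigcup_(D' in FF) D' `<=` A]].
  exists D, FF; split=> // e' e'D ne'; apply: (lives_sub sub).
  have fU : fin_bd (\bigcup_(D' in FF) D').
    by apply: finite_bd_bigcup => // D' /FT/(cut_tree_fin_bd T_tree).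
  rewrite setDE; apply: livesI => //; [exact: cut_tree_fin_bd T_tree _ TD|exact: fin_bd_setC|].
  apply/livesC => // /(lives_bigcup fFF)[|D' FD'].
    by move=> D' /FT/(cut_tree_fin_bd T_tree).
  exact: ne'.
have [||[D [TD eD] least]|[c Bc cS]] := @least_or_descending _ B.
- by have [D TD eD] := cut_tree_cover T_tree e; exists D.
- move=> D D' [TD eD] [TD' eD']; apply: (cut_tree_nested T_tree TD TD').
  exact: lives_meet (cut_tree_fin_bd T_tree TD) (cut_tree_fin_bd T_tree TD') eD eD'.
- have [|FF h] := cut_tree_least T_tree TD eD _ fA eA; last by exists D, FF.
  by move=> D' TD' eD'; apply: least.
- have Tc n : T (c n) by case: (Bc n).
  have ec n : lives e (c n) by case: (Bc n).
  have [n cA] := descending_cut (fun n => proj1 (cS n))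
    (fun n => cut_tree_connected T_tree (Tc n)) (cut_tree_cap T_tree Tc cS) fA.
  exists (c n), set0; split=> //; split=> //; rewrite bigcup_set0 setD0; apply: cA.
  exact: lives_meet (cut_tree_fin_bd T_tree (Tc n)) fA (ec n) eA.
Qed.

Lemma cut_tree_separates (e e' : edge_end G) :
  (forall D, T D -> lives e D <-> lives e' D) -> e = e'.
Proof.
move=> H; apply: edge_end_eq => A fA eA.
have [D [FF [[TD eD] _ FT nFF sub]]] := cut_tree_nbhd fA eA.
apply: sub; first by apply/H.
by move=> D' FD' /(H _ (FT _ FD')); exact: nFF.
Qed.

End CutTree.

Section Rank.
Variable G : graph.

(** [d] is the distance to a representative vertex chosen in each connected component. *)
Lemma rank_ex : exists d : G -> nat,
  (forall x, 0 < d x -> exists2 y, adj x y & d y < d x) /\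
  (forall x y, d x = 0 -> d y = 0 -> linked x y -> x = y).
Proof.
pose rep (x : G) := @xget {classic G} x [set y | linked x y].
have repP x : linked x (rep x) by apply: (@xgetPex {classic G} x); exists x; exact: rt_refl.
have rep_eq x y : linked x y -> rep x = rep y.
  move=> xy; rewrite /rep.
  have -> : [set z | linked x z] = [set z | linked y z].
    apply/seteqP; split=> z /=; last exact: rt_trans.
    exact: rt_trans (linked_sym xy).
  (* The defaults [x] and [y] of [xget] differ, but they are never returned because the class is
     non-empty. *)
  rewrite /xget; case: pselect => //; case; exists y; apply/asboolP; exact: rt_refl.
pose fix walk (k : nat) (x : G) {struct k} : Prop := if k is k'.+1 then
  exists2 y, adj x y & walk k' y else x = rep x.
have walk_ex x : exists k, walk k x.
  have := repP x; move/(clos_rt_rt1n _ _ _ _) => xr.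
  have : rep x = rep (rep x) by exact/rep_eq/repP.
  elim: xr => [y yE|y z w yz _ IH wE]; first by exists 0.
  by have [k kz] := IH wE; exists k.+1; exists z.
have /choice[d dP] : forall x, exists k, walk k x /\ forall j, walk j x -> k <= j.
  move=> x; have ex : exists k, `[< walk k x >].
    by have [k kx] := walk_ex x; exists k; apply/asboolP.
  by case: (ex_minnP ex) => k /asboolP kx min; exists k; split=> // j /asboolP/min.
exists d; split=> [x|x y].
  have [] := dP x; case: (d x) => // k [y xy ky] _ _; exists y => //.
  by rewrite ltnS; have [_] := dP y; apply.
have [+ _] := dP x; have [+ _] := dP y; move=> + + dx dy /rep_eq.
by rewrite dx dy /= => {2}-> {2}->.
Qed.

End Rank.

(** * Growing a tree of cuts in a graph *)

Section Tree.
Variable G : graph.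
Implicit Types D S B : set G.

Local Notation bd := (boundary (@adj G)).
Local Notation connected_on := (connected_on (@adj G)).

Definition region D : Prop := [/\ D !=set0, fin_bd D & connected_on D].

Lemma conn_linked D (x y : G) : conn (@adj G) D x y -> linked x y.
Proof.
elim=> [u v [uv _ _]|u|u v w _ uv _ vw].
- exact: rt_step.
- exact: rt_refl.
- exact: rt_trans uv vw.
Qed.

(** [star] is applied to the graph induced on [D]; passing back to [G] adds to a boundary only edges
    from the finite boundary of [D]. *)
Lemma relative_star D o : region D -> D o -> exists SS : set (set G),
  [/\ forall S, SS S -> [/\ region S, S `<=` D & ~ S o],
      forall S S', SS S -> SS S' -> S `&` S' !=set0 -> S = S' &
      forall B, B `<=` D -> ~ B o -> fin_bd B -> B `<=` \bigcup_(S in SS) S /\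
        finite_set [set S | SS S /\ S `&` B !=set0] ].
Proof.
move=> [_ fD cD] Do; pose E := restrict (@adj G) D.
have Esym x y : E x y -> E y x by move=> [xy Dx Dy]; split=> //; exact: adj_sym.
have sub_D x : conn E setT o x -> D x.
  by move=> ox; apply: contrapT => /(crt_exit ox Do)[u [v [[[_ _ Dv] _ _]]]].
have [SS [SS1 SS2 SS3]] := star o Esym; exists SS; split=> //.
- move=> S /SS1[[So nSo fS] Sne cS]; split=> //.
  + split=> //.
    * apply: (@sub_finite_set _ _ (boundary E S `|` bd D)); last by rewrite finite_setU.
      move=> [u v] [/= uv Su nSv]; have Du := sub_D _ (So _ Su).
      by have [Dv|nDv] := pselect (D v); [left|right].
    * move=> x y Sx Sy; elim: (cS x y Sx Sy) => [u v [[uv _ _] Su Sv]|u|u v w _ uv _ vw].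
      - exact: rt_step.
      - exact: rt_refl.
      - exact: rt_trans uv vw.
  + by move=> x /So/sub_D.
- move=> B BD nBo fB; apply: SS3; split=> //.
  + move=> x /BD Dx; elim: (cD o x Do Dx) => [u v uv|u|u v w _ uv _ vw].
    * exact: rt_step.
    * exact: rt_refl.
    * exact: rt_trans uv vw.
  + by apply: sub_finite_set fB => -[u v] [/= [uv _ _] Bu nBv].
Qed.

(** The depth [lev], which increases under strict inclusion, is what later makes the subbase
    noetherian. *)
Lemma cut_tree_exists : exists T : set (set G),
  cut_tree T /\ exists lev : set G -> nat,
    forall D D', T D -> T D' -> D' `<` D -> lev D < lev D'.
Proof.
have [[x0 _]|nG] := pselect (exists x : G, True); last first.
  exists set0; split; last by exists (fun=> 0).
  split=> // [c /(_ 0)//|e]; have [r _] := end_ofP e.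
  by case: nG; exists (r 0).
have [d [d_step d_zero]] := rank_ex G.
have /choice[root rootP] : forall D, exists o, region D ->
    D o /\ forall x, D x -> d o <= d x.
  move=> D; have [[[x Dx] _ _]|] := pselect (region D); last by exists x0.
  have ex : exists k, `[< exists2 y, D y & d y = k >].
    by exists (d x); apply/asboolP; exists x.
  case: (ex_minnP ex) => k /asboolP[o Do <-] min; exists o => _; split=> // y Dy.
  by apply: min; apply/asboolP; exists y.
have /choice[star starP] : forall D, exists SS : set (set G), region D ->
  [/\ forall S, SS S -> [/\ region S, S `<=` D & ~ S (root D)],
      forall S S', SS S -> SS S' -> S `&` S' !=set0 -> S = S' &
      forall B, B `<=` D -> ~ B (root D) -> fin_bd B -> B `<=` \bigcup_(S in SS) S /\
        finite_set [set S | SS S /\ S `&` B !=set0] ].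
  move=> D; have [rD|] := pselect (region D); last by exists set0.
  by have [SS] := relative_star rD (proj1 (rootP D rD)); exists SS.
pose fix level n := if n is n'.+1 then \bigcup_(D in level n') star D
  else [set component (@adj G) setT x | x in setT].
have bdT : bd setT = set0 by apply/seteqP; split=> // p [_ _ []].
have level_region n D : level n D -> region D.
  elim: n D => [_ [x _ <-]|n IH D [P /IH rP PD]]; last first.
    by have [/(_ _ PD)[]] := starP P rP.
  split; first by exists x; exact: rt_refl.
    by apply: sub_finite_set (bd_component _) _ => //; rewrite bdT.
  exact: component_connected (@adj_sym G) _ _ I.
have anc n k D : level (n + k) D -> exists2 P, level n P & D `<=` P.
  elim: k D => [|k IH] D; first by rewrite addn0; exists D.
  rewrite addnS => -[Q lQ QD].
  have [/(_ _ QD)[_ DQ _] _ _] := starP Q (level_region _ _ lQ).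
  by have [P lP QP] := IH Q lQ; exists P => //; exact: subset_trans QP.
have level_eq n D D' : level n D -> level n D' -> D `&` D' !=set0 -> D = D'.
  elim: n D D' => [_ _ [x _ <-] [y _ <-] [z [xz yz]]|n IH D D' [P lP PD] [P' lP' PD'] [z [Dz D'z]]].
    by rewrite (component_eq (@adj_sym G) xz) (component_eq (@adj_sym G) yz).
  have [/(_ _ PD)[_ DP _] disj _] := starP P (level_region _ _ lP).
  have [/(_ _ PD')[_ DP' _] _ _] := starP P' (level_region _ _ lP').
  have PE : P' = P by apply: IH => //; exists z; split; [exact: DP' | exact: DP].
  by apply: disj => //; [rewrite -PE | exists z].
have level_lt m n D D' : m < n -> level m D -> level n D' -> D `&` D' !=set0 ->
    D' `<=` D /\ ~ D' (root D).
  move=> /subnKC <- lD /anc[Q [P lP PQ] D'Q] [z [Dz D'z]].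
  have [/(_ _ PQ)[_ QP nQ] _ _] := starP P (level_region _ _ lP).
  have <- : P = D by apply: (level_eq m) => //; exists z; split=> //; apply/QP/D'Q.
  by split; [exact: subset_trans QP | move=> /D'Q].
pose T D := exists n, level n D.
have T_region D : T D -> region D by move=> [n /level_region].
have T_lt m n D D' : level m D -> level n D' -> D' `<` D -> m < n.
  move=> lD lD' [D'D nDD']; have [[x D'x] _ _] := level_region _ _ lD'.
  have meet : D' `&` D !=set0 by exists x; split=> //; exact: D'D.
  case: (ltngtP m n) => // [nm|mn]; first by have [] := level_lt _ _ _ _ nm lD' lD meet.
  by rewrite -mn in lD'; case: nDD'; rewrite (level_eq _ _ _ lD' lD meet).
have T_root D D' : T D -> T D' -> D' `<` D -> ~ D' (root D).
  move=> [m lD] [n lD'] D'D; have [[x D'x] _ _] := level_region _ _ lD'.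
  have [] // := level_lt _ _ _ _ (T_lt _ _ _ _ lD lD' D'D) lD lD'.
  by exists x; split=> //; exact: (proj1 D'D).
exists T; split; last first.
  have /choice[lev levP] : forall D, exists n, T D -> level n D.
    by move=> D; have [[n nD]|] := pselect (T D); [exists n | exists 0].
  by exists lev => D D' /levP lD /levP lD'; exact: T_lt.
split.
- by move=> D /T_region[].
- by move=> D /T_region[].
- move=> D D' [m lD] [n lD'] meet; case: (ltngtP m n) => [mn|nm|mn].
  + by right; have [] := level_lt _ _ _ _ mn lD lD' meet.
  + by rewrite setIC in meet; left; have [] := level_lt _ _ _ _ nm lD' lD meet.
  + by rewrite -mn in lD'; left; rewrite (level_eq _ _ _ lD lD' meet).
- move=> c Tc cS; apply/seteqP; split=> // x cx.
  (* With [x] in every [c n], the ranks of the roots are non-decreasing and bounded by [d x], hence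
     equal to some [k] from [N] on, while the roots are distinct. If [k] is zero, two linked roots
     of rank zero coincide. Otherwise each root has a neighbour of rank below [k], outside [c N] by
     minimality, so the boundary of [c N] is infinite. *)
  pose o n := root (c n).
  have oP n := rootP (c n) (T_region _ (Tc n)).
  have c_le := descending_le (fun n => proj1 (cS n)).
  have no n : ~ c n.+1 (o n) by apply: T_root.
  have ex : exists k, `[< exists n, d (o n) = k >].
    by exists (d (o 0)); apply/asboolP; exists 0.
  have bound k : `[< exists n, d (o n) = k >] -> k <= d x.
    by move=> /asboolP[n <-]; have [_] := oP n; apply; exact: cx.
  case: (ex_maxnP ex bound) => k /asboolP[N oN] max.
  have dk n : N <= n -> d (o n) = k.
    move=> Nn; apply/eqP; rewrite eqn_leq; apply/andP; split.
      by apply: max; apply/asboolP; exists n.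
    by rewrite -oN; have [_] := oP N; apply; apply: c_le Nn _ _; case: (oP n).
  have o_lt n m : n < m -> o n <> o m.
    by move=> nm onm; apply: (no n); rewrite onm; apply: c_le nm _ _; case: (oP m).
  have o_inj n m : o n = o m -> n = m.
    by case: (ltngtP n m) => // /o_lt h onm; [case: h | case: (h (esym onm))].
  have [k0|k_gt0] := posnP k.
    apply: (o_lt N N.+1) => //; apply: d_zero; rewrite ?dk //.
    have [_ _ cN] := T_region _ (Tc N).
    apply: conn_linked (cN _ _ _ _); first by case: (oP N).
    by apply: (proj1 (cS N)); case: (oP N.+1).
  have /choice[y yP] : forall n, exists y, adj (o (N + n)) y /\ d y < k.
    move=> n; have oNn := dk (N + n) (leq_addr _ _).
    by have := d_step (o (N + n)); rewrite oNn => /(_ k_gt0)[y oy dy]; exists y.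
  have bdN n : bd (c N) (o (N + n), y n).
    split; first by case: (yP n).
      by apply: (c_le N (N + n) (leq_addr _ _)); case: (oP (N + n)).
    have [_ min] := oP N; move=> /min; rewrite -/(o N) dk // leqNgt.
    by case: (yP n) => _ ->.
  have [_ fN _] := T_region _ (Tc N).
  have : finite_set ((fun n => (o (N + n), y n)) @^-1` bd (c N)).
    by apply: finite_preimage fN => n m _ _ [/o_inj/addnI].
  have -> : (fun n => (o (N + n), y n)) @^-1` bd (c N) = setT.
    by apply/seteqP; split=> // n _; exact: bdN.
  exact: infinite_nat.
- move=> e; have [r ->] := end_ofP e; exists (component (@adj G) setT (r 0)).
    by exists 0, (r 0).
  exists r; first exact: edge_equiv_refl.
  exists 0 => n _; elim: n => [|n IH]; first exact: rt_refl.
  by apply: rt_trans IH _; apply: rt_step; split=> //; exact: ray_adj.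
- move=> e D A TD eD least fA eA.
  have rD := T_region D TD; have [_ fD _] := rD; have [n lD] := TD.
  have [SSP disj cover] := starP D rD.
  have [oD _] := rootP D rD.
  have nlives S : star D S -> ~ lives e S.
    move=> SD /(least _ (ex_intro _ n.+1 (ex_intro2 _ _ D lD SD))) DS.
    by have [_ _ []] := SSP S SD; exact: DS.
  (* If the root were outside [A], finitely many children would cover the part of [D] in [A], and
     [e] would live in one of them. Hence the part of [D] outside [A] avoids the root and is itself
     covered by finitely many children. *)
  have Ao : A (root D).
    apply: contrapT => nAo; have fDA : fin_bd (D `&` A) by exact: finite_bd_setI.
    have [sub fin] := cover (D `&` A) (@subIsetl _ _ _) (fun DAo => nAo (proj2 DAo)) fDA.
    have : lives e (\bigcup_(S in [set S | star D S /\ S `&` (D `&` A) !=set0]) S).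
      apply: lives_sub (livesI fD fA eD eA) => x DAx.
      by have [S SD Sx] := sub x DAx; exists S => //; split=> //; exists x.
    move=> /(lives_bigcup fin)[S [SD _]|S [SD _]]; last exact: nlives.
    by have [[]] := SSP S SD.
  have fDA : fin_bd (D `\` A) by exact: finite_bd_setD (@adj_sym G) _ _ _ _.
  have [sub fin] := cover (D `\` A) (@subDsetl _ _ _) (fun DAo => proj2 DAo Ao) fDA.
  exists [set S | star D S /\ S `&` (D `\` A) !=set0]; split=> //.
  + by move=> S [SD _]; exists n.+1, D.
  + by move=> S [/nlives].
  + move=> x [Dx nx]; apply: contrapT => nAx; apply: nx.
    by have [S SD Sx] := sub x (conj Dx nAx); exists S => //; split=> //; exists x.
Qed.

End Tree.

(** * From graphs to subbases *)

From mathcomp Require Import finmap.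

Lemma open_nbhsP (X : topologicalType) (U : set X) :
  open U <-> forall x, U x -> nbhs x U.
Proof. by rewrite openE. Qed.

(** * Subbases, separation of points and hereditary completeness *)

Section Topology.
Variable X : topologicalType.
Implicit Types (C S : set (set X)) (x : X).

Lemma subbaseP S : subbase S <-> (forall A, S A -> open A) /\
  forall U x, open U -> U x -> exists FF, [/\ finite_set FF, FF `<=` S,
    forall A, FF A -> A x & \bigcap_(A in FF) A `<=` U].
Proof.
split=> [[So Sb]|[So Sb]].
  split=> [A SA|U x oU Ux]; first by apply: So; exact: (finI_from1 id SA).
  have [_ [[D DS <-] Dx] DU] := Sb x U (open_nbhs_nbhs (conj oU Ux)).
  exists [set` D]; split=> //.
  by move=> A /DS; rewrite in_setE.
split=> [_ [D DS <-]|x U].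
  apply/open_nbhsP => x Dx; apply: filter_bigI => A AD.
  apply: open_nbhs_nbhs; split; last exact: Dx.
  by apply: So; have := DS A AD; rewrite in_setE.
rewrite nbhsE => -[V [oV Vx] VU].
have [FF [/finite_fsetP[D ->] FS Fx FV]] := Sb V x oV Vx.
exists (\bigcap_(A in [set` D]) A); last exact: subset_trans VU.
by split=> //; exists D => // A AD; rewrite in_setE; exact: FS.
Qed.

Lemma continuous_subbase (Y : topologicalType) (f : Y -> X) S :
  subbase S -> (forall A, S A -> open (f @^-1` A)) -> continuous f.
Proof.
move=> /subbaseP[_ Sb] fS; apply/continuousP => U oU; apply/open_nbhsP => y Ufy.
have [FF [fF FS Fy FU]] := Sb U (f y) oU Ufy.
apply: (@filterS _ _ _ (\bigcap_(A in FF) (f @^-1` A))).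
  by move=> z Fz; apply: FU => A /Fz.
move/finite_fsetP: fF FS Fy FU => [D ->] FS Fy _.
apply: filter_bigI => A AD; apply: open_nbhs_nbhs.
by split; [apply: fS; exact: FS | exact: Fy].
Qed.

Lemma clopen_subbase_separates C x y : clopen_subbase C ->
  (forall A, C A -> A x <-> A y) -> forall U, open U -> U x -> U y.
Proof.
move=> [_ /subbaseP[_ Cb]] xy U oU Ux; have [FF [_ FC Fx FU]] := Cb U x oU Ux.
apply: FU => A FA; have := Fx A FA; case: (FC A FA) => [CA /(xy A CA)//|[B CB <-]].
by move=> nBx /(xy B CB).
Qed.

(** Points that no member of [C] tells apart lie in the same open sets, and the Kolmogorov axiom
    identifies them. *)
Lemma clopen_subbase_inj C x y : kolmogorov_space X -> clopen_subbase C ->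
  (forall A, C A -> A x <-> A y) -> x = y.
Proof.
move=> T0 Cb xy; apply: contrapT => /eqP/T0[A].
have sep a b : (forall A, C A -> A a <-> A b) -> A \in nbhs a -> b \in ~` A -> False.
  move=> ab; rewrite !in_setE nbhsE => -[U [oU Ua] UA]; apply; apply: UA.
  exact: (clopen_subbase_separates Cb ab).
by case=> -[]; apply: sep => // B CB; split=> /(xy B CB).
Qed.

(** The members whose traces lie in the centered family form a chain. A least one supplies a point
    directly. Otherwise take the unique point [x] of a descending sequence: it is in [Y], or else
    some [c n] would miss [Y]; and any other member contains some [c n], or lies below all of them
    and then contains [x] by uniqueness. *)
Lemma hereditarily_complete_of_descending C : (forall A, C A -> A !=set0) ->
  nested C -> singleton_intersection C ->
  (forall c : nat -> set X, (forall n, C (c n)) -> (forall n, c n.+1 `<` c n) ->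
    forall U x, open U -> U x -> (\bigcap_n c n) x -> exists n, c n `<=` U) ->
  hereditarily_complete C.
Proof.
move=> Cne Cnest Csing Cbase Y Ycl F FC [A0 FA0] Fcen.
pose B := [set A | C A /\ F (A `&` Y)].
have Fmeet A A' : F A -> F A' -> A `&` A' !=set0.
  move=> FA FA'; have [||x xP] := Fcen [set A; A'] _ (finite_set2 _ _).
  - by move=> _ [->|->].
  - by exists A; left.
  - by exists x; split; apply: xP; [left|right].
have Bmeet A A' : B A -> B A' -> (A `&` Y) `&` (A' `&` Y) !=set0.
  by move=> [_ FA] [_ FA']; exact: Fmeet.
have [A CA A0E] := FC A0 FA0.
have [||[M [CM FM] least]|[c Bc cS]] := @least_or_descending _ B.
- by exists A; split=> //; rewrite A0E.
- move=> A1 A2 B1 B2; have [x [[A1x _] [A2x _]]] := Bmeet _ _ B1 B2.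
  by apply: Cnest; [case: B1|case: B2|exists x].
- have [x [[Mx Yx] _]] := Bmeet M M (conj CM FM) (conj CM FM).
  exists x => A' FA'; have [A1 CA1 A1E] := FC A' FA'.
  by rewrite -A1E; split=> //; apply: least Mx; split=> //; rewrite A1E.
have Cc n : C (c n) by case: (Bc n).
have [x [cx xuniq]] := Csing c Cc cS.
have Yx : Y x.
  apply: contrapT => nYx; have oY : open (~` Y) by exact: closed_openC.
  have [n cnY] := Cbase c Cc cS _ _ oY nYx cx.
  by have [y [[/cnY nYy Yy] _]] := Bmeet _ _ (Bc n) (Bc n).
exists x => A' FA'; have [A1 CA1 A1E] := FC A' FA'; rewrite -A1E; split=> //.
have BA1 : B A1 by split=> //; rewrite A1E.
have [A1c|] := pselect (forall n, A1 `<=` c n).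
  have [y A1y] := Cne A1 CA1; rewrite (xuniq y) // => n _; exact: A1c.
move=> /existsNP[n nA1c]; have [y [[A1y _] [cy _]]] := Bmeet _ _ BA1 (Bc n).
have [//|cA1] := Cnest A1 (c n) CA1 (Cc n) (ex_intro _ y (conj A1y cy)).
by apply: cA1; exact: cx.
Qed.

End Topology.

Lemma open_lives (G : graph) (D : set G) : fin_bd D -> open [set e : edge_end G | lives e D].
Proof. by move=> fD; apply/edge_end_openP => e eD; exists D. Qed.

Lemma subbase_of_edge_end (X : topologicalType) (G : graph) :
  homeomorphic X (edge_end G) -> exists C : set (set X),
     [/\ clopen_subbase C, nested C, noetherian C, hereditarily_complete C
       & singleton_intersection C].
Proof.
move=> [f [g [fK gK fc gc]]].
have [T [Ttree [lev levP]]] := cut_tree_exists G.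
have Tfb D : T D -> fin_bd D by exact: cut_tree_fin_bd.
have Tconn D : T D -> connected_on (@adj G) D by exact: cut_tree_connected.
pose O D := [set x | lives (f x) D].
have O_open D : fin_bd D -> open (O D).
  by move=> fD; move/continuousP: fc => /(_ _ (open_lives fD)).
have O_C D : fin_bd D -> O (~` D) = ~` O D.
  by move=> fD; apply/seteqP; split=> x; move/livesC: fD => /(_ (f x)) [].
pose C A := exists D, [/\ T D, A = O D & A !=set0].
have C_ne A : C A -> A !=set0 by case=> D [].
have O_meet D D' : T D -> T D' -> O D `&` O D' !=set0 -> D `&` D' !=set0.
  by move=> /Tfb fD /Tfb fD' [x [xD xD']]; exact: lives_meet xD xD'.
have O_sub D D' : D `<=` D' -> O D `<=` O D' by move=> DD' x; exact: lives_sub.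
(* Distinct tree members may host the same ends, but a strict inclusion between sets of ends
   determines which of two nested members is larger. *)
have O_lt D D' : T D -> T D' -> O D !=set0 -> O D `<` O D' -> D `<` D'.
  move=> TD TD' [x xD] [OO nOO]; have meet : O D `&` O D' !=set0.
    by exists x; split=> //; exact: OO.
  have := cut_tree_nested Ttree TD TD' (O_meet _ _ TD TD' meet).
  by case=> [DD'|/O_sub//]; split=> // /O_sub.
have desc c : (forall n, C (c n)) -> (forall n, c n.+1 `<` c n) ->
    exists D, [/\ forall n, T (D n), forall n, c n = O (D n) & forall n, D n.+1 `<` D n].
  move=> /choice[D DP] cS; exists D.
  have TD n : T (D n) by case: (DP n).
  have cD n : c n = O (D n) by case: (DP n).
  split=> // n; have [_ E ne] := DP n.+1; apply: O_lt => //; rewrite -?E //.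
  by rewrite -cD; exact: cS.
have C_base (c : nat -> set X) : (forall n, C (c n)) -> (forall n, c n.+1 `<` c n) ->
    forall U x, open U -> U x -> (\bigcap_n c n) x -> exists n, c n `<=` U.
  move=> Cc cS U x oU Ux cx; have [D [TD cD DS]] := desc c Cc cS.
  have ogU : open (g @^-1` U) by move/continuousP: gc; apply.
  have [|A [fA xA AU]] := (proj1 (edge_end_openP _)) ogU (f x); first by rewrite /= fK.
  have [n Dn] := descending_cut (fun n => proj1 (DS n)) (fun n => Tconn _ (TD n))
    (cut_tree_cap Ttree TD DS) fA.
  have xD : lives (f x) (D n) by have := cx n I; rewrite cD.
  exists n => y; rewrite cD => yD; rewrite -[y]fK; apply: AU; apply: lives_sub yD.
  by apply: Dn; exact: lives_meet (Tfb _ (TD n)) fA xD xA.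
have C_nested : nested C.
  move=> _ _ [D [TD -> _]] [D' [TD' -> _]] /(O_meet _ _ TD TD').
  by move=> /(cut_tree_nested Ttree TD TD')[/O_sub|/O_sub]; [left|right].
have C_sing : singleton_intersection C.
  move=> c Cc cS; have [D [TD cD DS]] := desc c Cc cS.
  have Dcap := cut_tree_cap Ttree TD DS.
  have Dne n : D n !=set0.
    by have [x] := C_ne _ (Cc n); rewrite cD => /lives_ex.
  have [r rD] := descending_ray (fun n => proj1 (DS n)) (fun n => Tconn _ (TD n)) Dcap Dne.
  exists (g (end_of r)); split.
    by move=> n _; rewrite cD /O /= gK; apply/lives_end_of; [exact: Tfb | exact: rD].
  move=> x cx; rewrite -[x]fK; congr g; apply: edge_end_eq => A fA.
  move=> /(lives_end_of _ fA) rA.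
  have [n Dn] := descending_cut (fun n => proj1 (DS n)) (fun n => Tconn _ (TD n)) Dcap fA.
  have xD : lives (f x) (D n) by have := cx n I; rewrite cD.
  by apply: lives_sub xD; apply: Dn; exact: eventually_meet (rD n) rA.
exists C; split=> //; last exact: hereditarily_complete_of_descending.
- split=> //; apply/subbaseP; split=> [_ [[D [/Tfb fD -> _]]|[_ [D [/Tfb fD -> _]] <-]]|U x oU Ux].
  + exact: O_open.
  + by rewrite -O_C //; apply: O_open; exact: fin_bd_setC.
  have ogU : open (g @^-1` U) by move/continuousP: gc; apply.
  have [|A [fA xA AU]] := (proj1 (edge_end_openP _)) ogU (f x); first by rewrite /= fK.
  have [D [FF [[TD xD] fF FT nFF sub]]] := cut_tree_nbhd Ttree fA xA.
  (* Members hosting no end are dropped, since [C] has only non-empty sets; removing them excludes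
     no point. *)
  pose NE := [set ~` O D' | D' in FF `&` [set D' | O D' !=set0]].
  exists ([set O D] `|` NE); split.
  + by rewrite finite_setU; split; [exact: finite_set1|exact/finite_image/finite_setIl].
  + move=> _ [->|[D' [/FT TD' ne'] <-]]; [left|right].
      by exists D; split=> //; exists x.
    by exists (O D') => //; exists D'.
  + by move=> _ [->//|[D' [/nFF nD' _] <-]].
  + move=> y yP; rewrite -[y]fK; apply: AU; apply: sub; first exact: (yP (O D) (or_introl erefl)).
    move=> D' FD' yD'; have ne' : O D' !=set0 by exists y.
    by apply: (yP (~` O D')) => //; right; exists D'.
- move=> c Cc cS; have [D DP] := choice Cc.
  have TD n : T (D n) by case: (DP n).
  have cD n : c n = O (D n) by case: (DP n).
  (* The sequence is constant from an index of minimal depth on, as a later strict increase would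
     give a smaller depth. *)
  have ex : exists k, `[< exists n, lev (D n) = k >].
    by exists (lev (D 0)); apply/asboolP; exists 0.
  case: (ex_minnP ex) => k /asboolP[n nk] min; exists n => m nm.
  have c_le : c n `<=` c m.
    move: nm => /subnKC <-; elim: (m - n) => [|j IH]; first by rewrite addn0.
    by rewrite addnS; apply: subset_trans IH (cS _).
  apply/seteqP; split=> //; apply: contrapT => nc.
  have : D n `<` D m.
    by apply: O_lt => //; rewrite -!cD //; exact: C_ne.
  move=> /(levP _ _ (TD m) (TD n)); rewrite nk ltnNge min //.
  by apply/asboolP; exists m.
Qed.

(** * The graph of a tree of sets *)

Lemma finite_set_subset1 (T : Type) (A : set T) :
  (forall x y, A x -> A y -> x = y) -> finite_set A.
Proof.
move=> A1; have [[x Ax]|nA] := pselect (exists x, A x).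
  by apply: (@sub_finite_set _ _ [set x]); [move=> y Ay; exact: A1|exact: finite_set1].
by apply: (@sub_finite_set _ _ set0) => // x Ax; case: nA; exists x.
Qed.

Section TreeGraph.
Variables (X : Type) (P : set (set X)) (par : set X -> set X).
Hypotheses (P_ne : forall A, P A -> A !=set0) (P_nested : nested P)
  (P_noeth : noetherian P) (PT : P setT).
Hypothesis P_desc : forall B (c : nat -> set X), P B -> (forall n, P (c n)) ->
  (forall n, c n.+1 `<` c n) -> ~ (forall n, B `<=` c n).
Hypothesis P_cap : forall c : nat -> set X, (forall n, P (c n)) ->
  (forall n, c n.+1 `<` c n) -> \bigcap_n c n !=set0.
Hypothesis parP : forall A, P A -> A <> setT ->
  [/\ P (par A), A `<` par A & forall B, P B -> A `<` B -> par A `<=` B].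

Definition full (A : set X) : Prop :=
  P A /\ exists2 x, A x & forall B, P B -> B x -> A `<=` B.

(** The first clause gives the tree edges, between vertices with second coordinate 0; the second
    gives a complete graph over each full node. All other pairs are isolated vertices, and [cone]
    leaves them out. *)
Definition arc (u v : set X * nat) : Prop :=
  [/\ P u.1, u.1 <> setT, v.1 = par u.1, u.2 = 0 & v.2 = 0] \/
  [/\ full u.1, v.1 = u.1 & u.2 <> v.2].

Lemma par_lt A : P A -> A <> setT -> A `<` par A.
Proof. by move=> PA /(parP PA)[]. Qed.

Lemma arc_neq u v : arc u v -> u <> v.
Proof.
move=> [[Pu nu vE _ _]|[_ _ n]] E; last by apply: n; rewrite E.
by have [_] := par_lt Pu nu; rewrite -vE E; apply.
Qed.

Lemma tree_edgesP (a : set (set X * nat)) :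
  (exists u v, arc u v /\ a = [set u; v]) -> exists u v, u <> v /\ a = [set u; v].
Proof. by move=> [u [v [/arc_neq uv ->]]]; exists u, v. Qed.

(* The tree of the members of P, ordered by reverse inclusion, where an infinite
   complete graph is attached to each node A that is the smallest member of P
   containing some point. *)
Definition tree_graph : graph := Graph tree_edgesP.

Local Notation V := (vertex tree_graph).

Lemma tree_adjP (u v : V) : adj u v <-> arc u v \/ arc v u.
Proof.
split=> [[u' [v' [a' E]]]|].
  by have [[-> ->]|[-> ->]] := Defs.pair_eqE E; [left|right].
by case=> a; [exists u, v | exists v, u; rewrite setUC].
Qed.

Definition cone (A : set X) : set V :=
  [set v | [/\ P v.1, v.1 `<=` A & v.2 = 0 \/ full v.1] ].

Lemma cone_node A B : P B -> B `<=` A -> cone A (B, 0).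
Proof. by move=> PB BA; split=> //; left. Qed.

Lemma cone_sub A B : A `<=` B -> cone A `<=` cone B.
Proof. by move=> AB v [Pv vA h]; split=> //; exact: subset_trans AB. Qed.

Lemma cone_subP A B : P A -> cone A `<=` cone B -> A `<=` B.
Proof. by move=> PA /(_ _ (cone_node PA (@subset_refl _ A)))[]. Qed.

Lemma cone_meet A B : P A -> P B -> cone A `&` cone B !=set0 -> A `<=` B \/ B `<=` A.
Proof.
move=> PA PB [v [[Pv vA _] [_ vB _]]]; apply: P_nested => //.
by have [x vx] := P_ne Pv; exists x; split; [exact: vA | exact: vB].
Qed.

(** Complete graphs stay over one node and parents of proper subnodes stay below [A], so only the
    edge from [A] to its parent leaves. *)
Lemma cone_exit A (u v : V) : P A -> adj u v -> cone A u -> ~ cone A v ->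
  [/\ A <> setT, u = (A, 0) & v = (par A, 0)].
Proof.
case: u v => [B m] [B' m'] PA /tree_adjP uv [/= PB BA h] nv.
case: uv => -[] /=.
- move=> [_ nB /= B'E m0 m'0]; have [PpB _ pmin] := parP PB nB.
  have BE : B = A.
    apply: contrapT => BA'; apply: nv; rewrite B'E m'0; apply: cone_node => //.
    by apply: pmin => //; split=> // AB; apply: BA'; apply/seteqP.
  by rewrite -BE B'E m0 m'0.
- by move=> [fB /= B'E _]; case: nv; split=> //=; rewrite B'E //; right.
- move=> [/= PB' nB' BE m'0 m0]; case: nv; rewrite m'0; apply: cone_node => //.
  by apply: subset_trans BA; rewrite BE; have [] := par_lt PB' nB'.
- move=> [/= fB' BE _]; case: nv; split=> //=; rewrite -BE //; right.
  by rewrite BE.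
Qed.

Lemma cone_fin_bd A : P A -> fin_bd (cone A).
Proof.
move=> PA; apply: (@sub_finite_set _ _ [set ((A, 0), (par A, 0))]); last exact: finite_set1.
by move=> [u v] [/= uv Au nAv]; have [_ -> ->] := cone_exit PA uv Au nAv.
Qed.

(** Among the nodes below [A] not joined to [A], a maximal one would have a parent that is joined to
    [A]. *)
Lemma cone_connected A : P A -> connected_on (@adj tree_graph) (cone A).
Proof.
move=> PA; pose R := conn (@adj tree_graph) (cone A).
have to_A B : P B -> B `<=` A -> R (B, 0) (A, 0).
  move=> PB BA; apply: contrapT => nB.
  pose bad B' := [/\ P B', B' `<=` A & ~ R (B', 0) (A, 0)].
  have [||M [PM MA nM] Mmax] := @noetherian_max _ P bad P_noeth.
  - by move=> B' [].
  - by exists B.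
  have MneA : M <> A by move=> E; apply: nM; rewrite E; exact: rt_refl.
  have ltMA : M `<` A by split=> // AM; apply: MneA; apply/seteqP.
  have nM' : M <> setT by move=> E; case: ltMA => _; rewrite E; apply.
  have [PpM [MpM npM] pmin] := parP PM nM'; have pMA := pmin A PA ltMA.
  have [RpM|nRpM] := pselect (R (par M, 0) (A, 0)); last first.
    by apply: npM; rewrite (Mmax (par M)).
  apply: nM; apply: rt_trans RpM; apply: rt_step; split; [|exact: cone_node|exact: cone_node].
  by apply/tree_adjP; left; left.
have to_A' v : cone A v -> R v (A, 0).
  case: v => B m /[dup] cv [/= PB BA h]; apply: rt_trans (to_A B PB BA).
  case: m h cv => [|m] h cv; first exact: rt_refl.
  apply: rt_step; split=> //; last exact: cone_node.
  by case: h => // fB; apply/tree_adjP; left; right.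
move=> u v /to_A' uA /to_A' vA; apply: rt_trans uA _.
by apply: conn_sym vA; exact: adj_sym.
Qed.

Lemma cone_cap (c : nat -> set X) : (forall n, P (c n)) ->
  (forall n, c n.+1 `<` c n) -> \bigcap_n cone (c n) = set0.
Proof.
move=> Pc cS; apply/seteqP; split=> // v cv.
have [Pv _ _] := cv 0 I.
by apply: (P_desc Pv Pc cS) => n; have [] := cv n I.
Qed.

Lemma child_ex B t : P B -> P t -> B `<` t ->
  exists B', [/\ P B', B' <> setT, B `<=` B' & par B' = t].
Proof.
move=> PB Pt Bt; pose between B' := [/\ P B', B `<=` B' & B' `<` t].
have [||M [PM BM Mt] Mmax] := @noetherian_max _ P between P_noeth.
- by move=> B' [].
- by exists B; split.
have nM : M <> setT by move=> E; case: Mt => _; rewrite E; apply.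
exists M; split=> //; have [PpM [MpM npM] pmin] := parP PM nM.
have pMt := pmin t Pt Mt; apply/seteqP; split=> //; apply: contrapT => ntp.
by apply: npM; rewrite (Mmax (par M)) //; split=> //; exact: subset_trans MpM.
Qed.

Lemma ray_cone (r : ray tree_graph) : eventually_in r (cone setT).
Proof.
exists 0 => n _; have := ray_adj r n; move/tree_adjP.
case=> -[[/= Pu nu vE e1 e2]|[fu vE _]].
- by split=> //; left.
- by split=> //; [case: fu|right].
- by rewrite /cone /= vE e2; have [? _ _] := parP Pu nu; split=> //; left.
- by rewrite /cone /= vE; split=> //; [case: fu|right].
Qed.

(* A ray leaves the cone of a child of t only through the vertex (t, 0), which
   it visits at most once. *)
Lemma ray_stays (r : ray tree_graph) t : P t -> eventually_in r (cone t) ->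
  (forall B, P B -> B `<` t -> ~ eventually_in r (cone B)) ->
  full t /\ exists k, forall n, k <= n -> (r n).1 = t.
Proof.
move=> Pt [k0 rt] nrB.
have [k1 k1P] : exists k, forall n, k <= n -> r n <> (t, 0).
  have [[n0 rn0]|n] := pselect (exists n, r n = (t, 0)).
    exists n0.+1 => n ltn; rewrite -rn0 => /ray_inj E.
    by rewrite E ltnn in ltn.
  by exists 0 => m _ rm; apply: n; exists m.
have stay n : maxn k0 k1 <= n -> (r n).1 = t.
  rewrite geq_max => /andP[k0n k1n]; have [Pr rnt h] := rt n k0n.
  apply: contrapT => neq.
  have lt : (r n).1 `<` t by split=> // tr; apply: neq; apply/seteqP.
  have [B [PB nB rB pB]] := child_ex Pr Pt lt.
  apply: (nrB B PB); first by rewrite -pB; exact: par_lt.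
  exists n => m /subnKC <-; elim: (m - n) => [|j IH]; first by rewrite addn0.
  rewrite addnS; apply: contrapT => out.
  have [_ _ E] := cone_exit PB (ray_adj r (n + j)) IH out.
  by apply: (k1P (n + j).+1); [rewrite -addnS; exact: leq_trans k1n (leq_addr _ _) | rewrite E pB].
split; last by exists (maxn k0 k1).
(* Two consecutive vertices over the same [t] are not joined by a tree edge, as [par] strictly
   enlarges; so their edge belongs to a complete graph. *)
set k := maxn k0 k1 in stay.
have Ek := stay k (leqnn k); have EkS := stay k.+1 (leqnSn k).
have := ray_adj r k; move/tree_adjP; case=> -[[/= Pu nu vE _ _]|[fu _ _]].
- by have [_] := par_lt Pu nu; rewrite -vE Ek EkS; case.
- by rewrite -Ek.
- by have [_] := par_lt Pu nu; rewrite -vE Ek EkS; case.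
- by rewrite -EkS.
Qed.

(** A vertex [(t, m)] outside [A] would be adjacent to infinitely many ray vertices inside [A]. *)
Lemma cut_clique t (r : ray tree_graph) A k : full t ->
  (forall n, k <= n -> (r n).1 = t) -> fin_bd A -> eventually_in r A ->
  forall m, A (t, m).
Proof.
move=> ft rt fA [j rA] m; apply: contrapT => nA.
have bdA n : boundary (@adj tree_graph) A (r (k + j + n), (t, m)).
  have rAn : A (r (k + j + n)) by apply: rA; rewrite -addnA addnCA leq_addr.
  have rtn : (r (k + j + n)).1 = t by apply: rt; rewrite -addnA leq_addr.
  split=> //; apply/tree_adjP; left; right; split=> //=; rewrite ?rtn // => E.
  by apply: nA; rewrite -rtn -E; case: (r (k + j + n)) rAn.
have : finite_set ((fun n => (r (k + j + n), (t, m) : V)) @^-1` boundary (@adj tree_graph) A).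
  by apply: finite_preimage fA => n n' _ _ [/ray_inj/addnI].
have -> : (fun n => (r (k + j + n), (t, m) : V)) @^-1` boundary (@adj tree_graph) A = setT.
  by apply/seteqP; split=> // n _; exact: bdA.
exact: infinite_nat.
Qed.

(** Intersecting cones have nested nodes, but a child strictly inside another child [B'] would have
    its parent [t] inside [B']. *)
Lemma child_uniq t B B' (v : V) : P B -> B <> setT -> par B = t ->
  P B' -> B' <> setT -> par B' = t -> cone B v -> cone B' v -> B = B'.
Proof.
wlog BB' : B B' / B `<=` B'.
  move=> W PB nB pB PB' nB' pB' cB cB'.
  have [BB'|B'B] := cone_meet PB PB' (ex_intro _ v (conj cB cB')); first exact: W.
  by apply: esym; exact: W.
move=> PB nB pB PB' nB' pB' _ _; apply: contrapT => neq.
have [_ _ /(_ B' PB')] := parP PB nB; rewrite pB.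
have [_] := par_lt PB' nB'; rewrite pB' => ntB' tB'; apply: ntB'; apply: tB'.
by split=> // B'B; apply: neq; apply/seteqP.
Qed.

Lemma cone_cut_tree : cut_tree [set cone A | A in P].
Proof.
split.
- by move=> _ [A PA <-]; exact: cone_fin_bd.
- by move=> _ [A PA <-]; exact: cone_connected.
- by move=> _ _ [A PA <-] [B PB <-] /(cone_meet PA PB)[/cone_sub|/cone_sub]; [left|right].
- move=> c Tc cS; have /choice[a aP] : forall n, exists A, P A /\ cone A = c n.
    by move=> n; have [A PA E] := Tc n; exists A.
  have Pa n : P (a n) by case: (aP n).
  have cE : c = (fun n => cone (a n)) by apply/funext => n; case: (aP n).
  rewrite cE; apply: cone_cap => // n; have [] := cS n; rewrite cE => sub nsub.
  by split=> [|/cone_sub//]; exact: cone_subP.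
- move=> e; have [r ->] := end_ofP e; exists (cone setT); first by exists setT.
  by apply/lives_end_of; [exact: cone_fin_bd | exact: ray_cone].
move=> e _ A [t Pt <-] + least fA.
have [r er] := end_ofP e; rewrite {}er in least *.
move=> /(lives_end_of _ (cone_fin_bd Pt)) rt /(lives_end_of _ fA) rA.
have [|ft [k rk]] := ray_stays Pt rt.
  move=> B PB [_ ntB] rB; apply: ntB; apply: cone_subP => //.
  by apply: least; [exists B | apply/lives_end_of => //; exact: cone_fin_bd].
have tA := cut_clique ft rk fA rA.
(* The complete graph over [t] lies in [A]. A child whose cone is not inside [A] therefore has a
   boundary edge of [A] in its cone or from [(t, 0)] to its top, and each end of such an edge
   determines at most one child. *)
pose bad B := [/\ P B, B <> setT, par B = t & ~ cone B `<=` A].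
exists [set cone B | B in bad]; split.
- apply: finite_image.
  apply: (@sub_finite_set _ _ (\bigcup_(p in boundary (@adj tree_graph) A)
    ([set B | bad B /\ cone B p.1] `|` [set B | bad B /\ cone B p.2]))); last first.
    apply: bigcup_finite => // p _; rewrite finite_setU.
    by split; apply: finite_set_subset1 => B B' [[PB nB pB _] cB] [[PB' nB' pB' _] cB'];
      exact: (child_uniq PB nB pB PB' nB' pB' cB cB').
  move=> B /[dup] bB [PB nB pB nBA].
  have [B0|nB0] := pselect (A (B, 0)); last first.
    exists ((t, 0), (B, 0)); last by right; split=> //; exact: cone_node.
    by split=> //=; apply/(tree_adjP (t, 0) (B, 0)); right; left; split.
  have [z Bz nAz] : exists2 z, cone B z & ~ A z.
    apply: contrapT => n; apply: nBA => z Bz; apply: contrapT => nAz.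
    by apply: n; exists z.
  have BB := cone_node PB (@subset_refl _ B).
  have [u [v [[uv Bu Bv] Au nAv]]] := crt_exit (cone_connected PB BB Bz) B0 nAz.
  by exists (u, v); [split | left].
- by move=> _ [B [PB _ _ _] <-]; exists B.
- move=> _ [B [PB nB pB _] <-] rB.
  have [_] := par_lt PB nB; rewrite pB; apply; apply: cone_subP => //.
  by apply: least => //; exists B.
- move=> v [[Pv vt hv] nv]; have [E|neq] := pselect (v.1 = t).
    by case: v E {Pv vt hv nv} => /= _ m ->; exact: tA.
  have lt : v.1 `<` t by split=> // tv; apply: neq; apply/seteqP.
  have [B [PB nB vB pB]] := child_ex Pv Pt lt.
  apply: contrapT => nAv; apply: nv; exists (cone B); last by split.
  by exists B => //; split=> // /(_ v) h; apply: nAv; apply: h; split.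
Qed.

(** By [P_desc] no member lies below the whole sequence, so by nestedness a member meeting every
    [c n] contains one of them. *)
Lemma point_or_chain (B : set (set X)) : B `<=` P -> B setT ->
  (forall A A', B A -> B A' -> A `&` A' !=set0) ->
  (exists2 t, B t & forall A, B A -> t `<=` A) \/
  exists c : nat -> set X, [/\ forall n, B (c n), forall n, c n.+1 `<` c n &
    forall A, P A -> (forall n, A `&` c n !=set0) -> exists n, c n `<=` A].
Proof.
move=> BP BT Bmeet; have [||[t Bt least]|[c Bc cS]] := @least_or_descending _ B.
- by exists setT.
- by move=> A A' BA BA'; apply: P_nested; [exact: BP|exact: BP|exact: Bmeet].
- by left; exists t.
right; exists c; split=> // A PA meet; apply: contrapT => n.
apply: (P_desc PA (fun n => BP _ (Bc n)) cS) => m.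
have [//|cA] := P_nested PA (BP _ (Bc m)) (meet m).
by case: n; exists m.
Qed.

(** A least member containing [x] is full, and the end is that of its complete graph; otherwise
    [descending_ray] supplies a ray through the cones of the sequence. *)
Lemma end_of_point x : exists e : edge_end tree_graph,
  forall A, P A -> A x <-> lives e (cone A).
Proof.
have [|||[t [Pt tx] least]|[c [Bc cS cP]]] := @point_or_chain [set A | P A /\ A x].
- by move=> A [].
- by [].
- by move=> A A' [_ Ax] [_ A'x]; exists x.
- have ft : full t by split=> //; exists x => // B PB Bx; apply: least.
  pose s n : V := (t, n).
  have s_inj : injective s by move=> m n [].
  have s_adj n : adj (s n) (s n.+1).
    by apply/tree_adjP; left; right; split=> //=.
  exists (end_of (Ray s_inj s_adj)) => A PA; split=> [Ax|].
    apply/lives_end_of; first exact: cone_fin_bd.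
    by exists 0 => n _; split=> //; [apply: least | right].
  move=> /(lives_end_of _ (cone_fin_bd PA))[k /(_ k (leqnn k))[_ tA _]]; exact: tA.
have Pc n : P (c n) by case: (Bc n).
have [r rc] := @descending_ray tree_graph (fun n => cone (c n))
  (fun n => cone_sub (proj1 (cS n))) (fun n => cone_connected (Pc n))
  (cone_cap Pc cS) (fun n => ex_intro _ _ (cone_node (Pc n) (@subset_refl _ _))).
exists (end_of r) => A PA; split=> [Ax|/(lives_end_of _ (cone_fin_bd PA)) rA].
  apply/lives_end_of; first exact: cone_fin_bd.
  have [|n cA] := cP A PA; first by move=> n; exists x; case: (Bc n).
  exact: eventually_sub (cone_sub cA) (rc n).
have [|n cA] := cP A PA; last by apply: cA; case: (Bc n).
move=> n; have [v [[Pv vA _] [_ vc _]]] := eventually_meet rA (rc n).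
by have [y vy] := P_ne Pv; exists y; split; [exact: vA | exact: vc].
Qed.

(** A least node hosting the end is full by [ray_stays], and the witness of fullness is the point;
    otherwise [P_cap] gives a point of the sequence. *)
Lemma point_of_end (e : edge_end tree_graph) : exists x,
  forall A, P A -> A x <-> lives e (cone A).
Proof.
have meet A A' : P A -> P A' -> lives e (cone A) -> lives e (cone A') -> A `&` A' !=set0.
  move=> PA PA' eA eA'; have [v [[Pv vA _] [_ vA' _]]] :=
    lives_meet (cone_fin_bd PA) (cone_fin_bd PA') eA eA'.
  by have [y vy] := P_ne Pv; exists y; split; [exact: vA | exact: vA'].
have [r er] := end_ofP e.
have eT : lives e (cone setT).
  by rewrite er; apply/lives_end_of; [exact: cone_fin_bd | exact: ray_cone].
have [|||[t [Pt et] least]|[c [Bc cS cP]]] := @point_or_chain [set A | P A /\ lives e (cone A)].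
- by move=> A [].
- by [].
- by move=> A A' [PA eA] [PA' eA']; exact: meet.
- have [||[_ [x tx tmin]] _] := @ray_stays r t Pt.
  + by apply/lives_end_of; [exact: cone_fin_bd | rewrite -er].
  + move=> B PB [_ ntB] rB; apply: ntB; apply: least; split=> //.
    by rewrite er; apply/lives_end_of => //; exact: cone_fin_bd.
  exists x => A PA; split=> [Ax|eA]; last by apply: least tx.
  by apply: lives_sub et; apply: cone_sub; exact: tmin.
have Pc n : P (c n) by case: (Bc n).
have [x cx] := P_cap Pc cS; exists x => A PA; split=> [Ax|eA].
  have [|n cA] := cP A PA; first by move=> n; exists x; split=> //; exact: cx.
  by apply: lives_sub (cone_sub cA) _; case: (Bc n).
have [|n cA] := cP A PA; last by apply: cA; exact: cx.
by move=> n; apply: meet => //; case: (Bc n).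
Qed.

End TreeGraph.

(** * From subbases to graphs *)

Section FromSubbase.
Variables (X : topologicalType) (C : set (set X)).
Hypotheses (C_sub : clopen_subbase C) (C_nested : nested C) (C_noeth : noetherian C)
  (C_hc : hereditarily_complete C) (C_sing : singleton_intersection C).

Lemma clopen_subbase_clopen A : C A -> open A /\ open (~` A).
Proof.
have [_ /subbaseP[Co _]] := C_sub => CA.
by split; apply: Co; [left|right; exists A].
Qed.

(* The intersection of a strictly descending sequence above B is a singleton
   {x}, so B = {x} is open.  On the closed set X \ {x} the traces of the sequence
   form a centered family with empty intersection. *)
Lemma no_descending_above B (c : nat -> set X) : C B -> (forall n, C (c n)) ->
  (forall n, c n.+1 `<` c n) -> ~ (forall n, B `<=` c n).
Proof.
move=> CB Cc cS Bc; have [x [cx xuniq]] := C_sing Cc cS.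
have Bx y : B y -> x = y by move=> By; apply: xuniq => n _; exact: Bc.
have clB : closed (~` B) by rewrite closedC; case: (clopen_subbase_clopen CB).
pose F := range (fun n => c n `&` ~` B).
have [||F' F'F fF' [A0 F'A0]|y yP] := C_hc clB (F := F).
- by move=> _ [n _ <-]; exists (c n).
- by exists (c 0 `&` ~` B); exists 0.
- have /choice[ix ixP] : forall A, exists n, F' A -> c n `&` ~` B = A.
    move=> A; have [/F'F[n _ <-]|] := pselect (F' A); first by exists n.
    by exists 0.
  have /finite_seqP[l lE] : finite_set (ix @` F') by exact: finite_image.
  (* A point of [c N] outside [c N.+1] lies in all the selected traces: it avoids [B], which is
     contained in [c N.+1]. *)
  pose N := \max_(j <- l) j; have [cNS ncN] := cS N.
  have [y cy ncy] : exists2 y, c N y & ~ c N.+1 y.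
    apply: contrapT => n; apply: ncN => y cy; apply: contrapT => ncy.
    by apply: n; exists y.
  exists y => A F'A; rewrite -(ixP A F'A); split; last by move=> /(Bc N.+1).
  apply: (descending_le (fun n => proj1 (cS n))) cy.
  have : (ix @` F') (ix A) by exists A.
  by rewrite lE => il; exact: (@leq_bigmax_seq _ l predT id _ il isT).
have yc : (\bigcap_n c n) y.
  by move=> n _; have [] := yP (c n `&` ~` B) (ex_intro2 _ _ n I erefl).
have [b Bb] := proj1 C_sub B CB.
have [_] := yP (c 0 `&` ~` B) (ex_intro2 _ _ 0 I erefl).
by apply; rewrite -(xuniq y yc) (Bx b Bb).
Qed.

Lemma edge_end_of_subbase : kolmogorov_space X ->
  exists G : graph, homeomorphic X (edge_end G).
Proof.
move=> T0; have [[x0 _]|nX] := pselect (exists x : X, True); last first.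
  pose G := @Graph X set0 (fun a (h : set0 a) => False_ind _ h).
  have nG (e : edge_end G) : False.
    by have [r _] := end_classP e; apply: nX; exists (r 0).
  exists G, (fun x => False_rect _ (nX (ex_intro _ x I))), (fun e => False_rect _ (nG e)).
  split=> [x|e|x|e]; [by case: nX; exists x|by case: (nG e)|by case: nX; exists x|].
  by case: (nG e).
(* The whole space is added as a root, which joins the forest of members into one tree. *)
pose P := C `|` [set setT].
have PC A : P A -> A <> setT -> C A by case.
have P_ne A : P A -> A !=set0.
  by move=> [/(proj1 C_sub)//|->]; exists x0.
have P_nested : nested P.
  by move=> A B [CA|->] [CB|->]; [exact: C_nested|left|right|left].
(* Only the first set of a strictly descending sequence can be the whole space. *)
have P_shift (c : nat -> set X) : (forall n, P (c n)) -> (forall n, c n.+1 `<` c n) ->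
    forall n, C (c n.+1).
  move=> Pc cS n; apply: PC => // E; have [_] := cS n; rewrite E; exact.
have P_noeth : noetherian P.
  move=> c Pc cS; have c_le n k : c n `<=` c (n + k).
    by elim: k => [|k IH]; rewrite ?addn0 // addnS; exact: subset_trans (cS _).
  have [[n cn]|nT] := pselect (exists n, c n = setT).
    by exists n => m /subnKC <-; apply/seteqP; split; [exact: c_le|rewrite cn].
  by apply: C_noeth => // n; apply: PC => // E; apply: nT; exists n.
have P_desc (B : set X) (c : nat -> set X) : P B -> (forall n, P (c n)) ->
    (forall n, c n.+1 `<` c n) -> ~ (forall n, B `<=` c n).
  move=> PB Pc cS Bc; have Cc := P_shift c Pc cS.
  apply: (@no_descending_above B _ _ Cc) => //; apply: PC => // E.
  by have [_] := cS 0; apply => x _; apply: (Bc 1); rewrite E.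
have P_cap (c : nat -> set X) : (forall n, P (c n)) ->
    (forall n, c n.+1 `<` c n) -> \bigcap_n c n !=set0.
  move=> Pc cS; have [x [xc _]] := C_sing (P_shift c Pc cS) (fun n => cS n.+1).
  by exists x => -[|n] _; [apply: (proj1 (cS 0)); exact: xc|exact: xc].
have PT : P setT by right.
have /choice[par parP] : forall A, exists B, P A -> A <> setT ->
    [/\ P B, A `<` B & forall B', P B' -> A `<` B' -> B `<=` B'].
  move=> A; have [[PA nA]|n] := pselect (P A /\ A <> setT); last first.
    by exists A => PA nA; case: n.
  (* The members strictly above [A] form a chain, and a descending sequence in it is excluded by
     [P_desc]; its least set is the parent. *)
  have [||[B [PB AB] least]|[c Bc cS]] := @least_or_descending _ [set B | P B /\ A `<` B].
  - by exists setT; split=> //; split=> // TA; apply: nA; apply/seteqP.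
  - move=> B B' [PB [AB _]] [PB' [AB' _]]; apply: P_nested => //.
    by have [x Ax] := P_ne A PA; exists x; split; [exact: AB | exact: AB'].
  - by exists B => _ _; split=> // B' PB' AB'; exact: least.
  - case: (P_desc A c PA) => // n; first by case: (Bc n).
    by have [_ []] := Bc n.
pose cn := @cone _ _ _ parP.
have Ctree : cut_tree [set cn A | A in P] by exact: cone_cut_tree.
have /choice[f fP] : forall x, exists e, forall A, P A -> A x <-> lives e (cn A).
  exact: end_of_point.
have /choice[g gP] : forall e, exists x, forall A, P A -> A x <-> lives e (cn A).
  exact: point_of_end.
have cfb A : P A -> fin_bd (cn A) by exact: cone_fin_bd.
exists (tree_graph parP), f, g; split.
(* Both maps preserve membership in the sets of [P], which separate the points of [X] and, through
   their cones, the ends. *)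
- move=> x; apply: clopen_subbase_inj T0 C_sub _ => A CA.
  have PA : P A by left.
  exact: iff_trans (gP (f x) A PA) (iff_sym (fP x A PA)).
- move=> e; apply: (cut_tree_separates Ctree) => _ [A PA <-].
  exact: iff_trans (iff_sym (fP (g e) A PA)) (gP e A PA).
- apply/continuousP => U oU; apply/open_nbhsP => x Ufx.
  have [A [fA xA AU]] := proj1 (edge_end_openP U) oU _ Ufx.
  have [D [FF [[TD xD] fF FT nFF sub]]] := cut_tree_nbhd Ctree fA xA.
  have P_open B : P B -> open B /\ open (~` B).
    move=> [/clopen_subbase_clopen//|->]; split; first exact: openT.
    by rewrite setCT; exact: open0.
  have [B PB BD] := TD.
  apply: (@filterS _ _ _ (B `&` \bigcap_(D' in FF) [set y | ~ lives (f y) D'])).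
    move=> y [By yFF]; apply: AU; apply: sub; first by rewrite -BD; apply/fP.
    exact: yFF.
  apply: filterI.
    apply: open_nbhs_nbhs; split; first by case: (P_open B PB).
    by apply/(fP x B PB); rewrite BD.
  have xFF := nFF; move/finite_fsetP: fF FT xFF => [E ->] FT xFF.
  apply: filter_bigI => D' ED'; have [B' PB' BD'] := FT D' ED'.
  have -> : [set y | ~ lives (f y) D'] = ~` B'.
    rewrite -BD'; apply/seteqP; split=> y n h; apply: n; exact/(fP y B' PB').
  apply: open_nbhs_nbhs; split; first by case: (P_open B' PB').
  by move=> xB'; apply: (xFF D' ED'); rewrite -BD'; exact/(fP x B' PB').
- have [_ Csb] := C_sub; apply: (continuous_subbase Csb).
  have gE A : P A -> g @^-1` A = [set e | lives e (cn A)].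
    by move=> PA; apply/seteqP; split=> e h; exact/(gP e A PA).
  move=> A [CA|[{}A CA <-]].
    by rewrite gE; [apply: open_lives; apply: cfb; left|left].
  have PA : P A by left.
  have -> : g @^-1` (~` A) = [set e | lives e (~` cn A)].
    apply/seteqP; split=> e.
      by move=> nA; apply/livesC; [exact: cfb|move=> eA; apply: nA; exact/(gP e A PA)].
    by move=> /(livesC _ (cfb A PA)) nA Age; apply: nA; exact/(gP e A PA).
  by apply: open_lives; apply: fin_bd_setC; exact: cfb.
Qed.

End FromSubbase.

Theorem theorem1p1 (X : topologicalType) (X_T0 : kolmogorov_space X) :
  (exists G : graph, homeomorphic X (edge_end G)) <->
  (exists C : set (set X),
     [/\ clopen_subbase C, nested C, noetherian C, hereditarily_complete C
       & singleton_intersection C]).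
Proof.
split=> [[G]|[C [C1 C2 C3 C4 C5]]]; first exact: subbase_of_edge_end.
exact: (edge_end_of_subbase C1 C2 C3 C4 C5).
Qed.
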